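(* For every rational $0<s<1$, the set $\{e:\mathcal H^s([T_e])<\infty\}$ is $\Sigma^0_3$-complete.
   Context: For each $e$, $T_e=\{\sigma\in2^{<\omega}:\forall\tau\subseteq\sigma\ \varphi_{e,|\sigma|}(\tau)\uparrow\}$ is the $e$-th recursive tree, where $\varphi_{e,t}$ denotes the $e$-th partial recursive function run for $t$ steps; $[T]$ denotes the set of infinite paths through $T$. Cantor space $2^\omega$ carries the metric $d(x,y)=2^{-\min\{n:x(n)\ne y(n)\}}$ for $x\ne y$; $\mathcal H^s$ denotes $s$-dimensional Hausdorff measure with respect to this metric. *)

(* Defs.v *)
From Stdlib Require Import Reals Lra Lia Arith List ClassicalEpsilon.
Import ListNotations.
Open Scope R_scope.

Definition cpair (a b : nat) : nat := ((a + b) * (a + b + 1) / 2 + b)%nat.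

Fixpoint cunpair (n : nat) : nat * nat :=
  match n with
  | O => (0%nat, 0%nat)
  | S n' => let (a, b) := cunpair n' in
            match a with
            | O => (S b, 0%nat)
            | S a' => (a', S b)
            end
  end.

Inductive code : Type :=
| CZero
| CSucc
| CId
| CFst
| CSnd
| CComp (f g : code)
| CPair (f g : code)
| CPrimRec (f g : code)       (* h<a,0> = f a ; h<a,k+1> = g <a,<k,h<a,k>>> *)
| CMin (f : code).            (* <a,k> |-> least j >= k with f<a,j> = 0 *)

Fixpoint eval (t : nat) (c : code) (x : nat) {struct t} : option nat :=
  match t with
  | O => None
  | S t' =>
    match c with
    | CZero => Some 0%nat
    | CSucc => Some (S x)
    | CId => Some x
    | CFst => Some (fst (cunpair x))
    | CSnd => Some (snd (cunpair x))
    | CComp f g =>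
        match eval t' g x with Some y => eval t' f y | None => None end
    | CPair f g =>
        match eval t' f x, eval t' g x with
        | Some a, Some b => Some (cpair a b)
        | _, _ => None
        end
    | CPrimRec f g =>
        let (a, k) := cunpair x in
        match k with
        | O => eval t' f a
        | S k' =>
            match eval t' (CPrimRec f g) (cpair a k') with
            | Some r => eval t' g (cpair a (cpair k' r))
            | None => None
            end
        end
    | CMin f =>
        let (a, k) := cunpair x in
        match eval t' f (cpair a k) with
        | Some O => Some k
        | Some (S _) => eval t' (CMin f) (cpair a (S k))
        | None => None
        end
    end
  end.

(* Goedel numbering: a surjection nat -> code (tag = n mod 9). *)
Fixpoint decode_aux (fuel n : nat) : code :=
  match fuel with
  | O => CZero
  | S fuel' =>
    let m := (n / 9)%nat in
    let '(i, j) := cunpair m in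
    match (n mod 9)%nat with
    | 0 => CZero
    | 1 => CSucc
    | 2 => CId
    | 3 => CFst
    | 4 => CSnd
    | 5 => CComp (decode_aux fuel' i) (decode_aux fuel' j)
    | 6 => CPair (decode_aux fuel' i) (decode_aux fuel' j)
    | 7 => CPrimRec (decode_aux fuel' i) (decode_aux fuel' j)
    | _ => CMin (decode_aux fuel' m)
    end
  end.

Definition decode (e : nat) : code := decode_aux (S e) e.

Definition conv_in (e t x : nat) : Prop := exists y, eval t (decode e) x = Some y.

Definition computes (c : code) (f : nat -> nat) : Prop :=
  forall x, exists t, eval t c x = Some (f x).
Definition computable (f : nat -> nat) : Prop := exists c, computes c f.

Definition Sigma03 (A : nat -> Prop) : Prop :=
  exists f : nat -> nat, computable f /\
    forall e, A e <-> exists a, forall b, exists c,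
        f (cpair e (cpair a (cpair b c))) = 0%nat.

Definition Sigma03_complete (A : nat -> Prop) : Prop :=
  Sigma03 A /\
  forall B : nat -> Prop, Sigma03 B ->
    exists g : nat -> nat, computable g /\ forall n, B n <-> A (g n).

(* strings sigma in 2^{<omega} are lists; sigma(0) is the head *)
Fixpoint code_str (s : list bool) : nat :=
  match s with
  | [] => 0%nat
  | b :: l => (2 * code_str l + (if b then 2 else 1))%nat
  end.

Definition prefix (tau sigma : list bool) : Prop := exists rho, sigma = tau ++ rho.

Definition inT (e : nat) (sigma : list bool) : Prop :=
  forall tau, prefix tau sigma -> ~ conv_in e (length sigma) (code_str tau).

Definition initial (x : nat -> bool) (n : nat) : list bool := map x (seq 0 n).

Definition paths (e : nat) (x : nat -> bool) : Prop :=
  forall n, inT e (initial x n).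

Definition sup_or0 (E : R -> Prop) : R :=
  match excluded_middle_informative (bound E) with
  | left Hb =>
      match excluded_middle_informative (exists r, E r) with
      | left Hne => proj1_sig (completeness E Hb Hne)
      | right _ => 0
      end
  | right _ => 0
  end.

(* d(x,y) = 2^{-min{n : x n <> y n}} for x <> y, and 0 for x = y
   (written as the sup of 2^{-n} over the n where x, y differ) *)
Definition dist (x y : nat -> bool) : R :=
  sup_or0 (fun r => exists n, x n <> y n /\ r = (/ 2) ^ n).

Definition diam (U : (nat -> bool) -> Prop) : R :=
  sup_or0 (fun r => exists x y, U x /\ U y /\ r = dist x y).

Definition powr (t s : R) : R := if Rle_dec t 0 then 0 else Rpower t s.

Definition delta_cover (delta : R) (A : (nat -> bool) -> Prop)
  (U : nat -> (nat -> bool) -> Prop) : Prop :=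
  (forall x, A x -> exists i, U i x) /\ (forall i, diam (U i) <= delta).

(* H^s_delta(A) <= M  (i.e. inf over delta-covers of sum diam^s is <= M) *)
Definition Hs_delta_le (s delta : R) (A : (nat -> bool) -> Prop) (M : R) : Prop :=
  forall eps, 0 < eps -> exists U, delta_cover delta A U /\
    forall N, sum_f_R0 (fun i => powr (diam (U i)) s) N <= M + eps.

(* H^s(A) = sup_{delta>0} H^s_delta(A) < infinity *)
Definition Hs_finite (s : R) (A : (nat -> bool) -> Prop) : Prop :=
  exists M : R, forall delta, 0 < delta -> Hs_delta_le s delta A M.

(* Main.v *)
(* Membership: by compactness and since constant factors are irrelevant, H^s([T]) < oo iff for some
   natural M and every n the tree has a finite cover by cylinders of length >= n and total weight
   at most M, where a cylinder of length l weighs 2^(-floor(s l)). That a finite cover works is a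
   semidecidable condition on a witness, by means of a universal machine, so this is of the form
   "exists M, forall n, exists a witness".

   Hardness: let [T] be the homogeneous tree in which level l branches or is forced to 0, and let
   cnt(l) be the number of branching levels below l. Then H^s([T]) is infinite if
   cnt(l) - s l tends to infinity, and finite if cnt(l) - s l is bounded along a subsequence.
   Branching is steered so that the liminf of cnt(l) - floor(s l) is finite iff that of a
   computable sequence h_t is: at stage t one refrains from branching until
   cnt(l) <= floor(s l) + h_t, then branches once and passes to stage t+1. For
   B = {n : exists a, forall b, exists c, f(n,a,b,c) = 0} take h_t = a if t is the triple of
   a, b and the least bound below which all b' <= b have witnesses c for a, and h_t = t otherwise:
   the value a recurs infinitely often iff a witnesses n in B. *)

Require Import Defs.
From Stdlib Require Import Reals Lra Lia Arith List ClassicalEpsilon.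
Import ListNotations.
Open Scope R_scope.

Local Open Scope nat_scope.

(** * Computable functions *)

Definition p1 (n : nat) : nat := fst (cunpair n).
Definition p2 (n : nat) : nat := snd (cunpair n).

Lemma triangle_S (n : nat) : S n * (S n + 1) / 2 = n * (n + 1) / 2 + S n.
Proof.
  replace (S n * (S n + 1)) with (n * (n + 1) + S n * 2) by lia.
  now rewrite Nat.div_add by lia.
Qed.

(** With [cpair_S_r] this shows that [cpair] numbers the antidiagonals in the very order in which
    the recursion of [cunpair] walks through them. *)
Lemma cpair_S_0 (b : nat) : cpair (S b) 0 = S (cpair 0 b).
Proof.
  unfold cpair. rewrite !Nat.add_0_r, !Nat.add_0_l, triangle_S. lia.
Qed.

Lemma cpair_S_r (a b : nat) : cpair a (S b) = S (cpair (S a) b).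
Proof. unfold cpair. replace (a + S b) with (S a + b) by lia. lia. Qed.

Lemma cpair_cunpair (n : nat) : cpair (p1 n) (p2 n) = n.
Proof.
  unfold p1, p2. induction n as [|n IH]; [reflexivity|].
  simpl. destruct (cunpair n) as [[|a] b]; simpl in *.
  - now rewrite cpair_S_0, IH.
  - now rewrite cpair_S_r, IH.
Qed.

Lemma cunpair_cpair (a b : nat) : cunpair (cpair a b) = (a, b).
Proof.
  remember (a + b) as n eqn:Hn. revert a b Hn.
  induction n as [|n IHn]; intros a b; revert a.
  - intros a Hn. replace a with 0 by lia. replace b with 0 by lia. reflexivity.
  - induction b as [|b IHb]; intros a Hn.
    + destruct a as [|a]; [lia|].
      rewrite cpair_S_0. simpl. rewrite IHn by lia. reflexivity.
    + rewrite cpair_S_r. simpl. rewrite IHb by lia. reflexivity.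
Qed.

Lemma p1_cpair (a b : nat) : p1 (cpair a b) = a.
Proof. unfold p1. now rewrite cunpair_cpair. Qed.

Lemma p2_cpair (a b : nat) : p2 (cpair a b) = b.
Proof. unfold p2. now rewrite cunpair_cpair. Qed.

Lemma cunpair_p1_p2 (n : nat) : cunpair n = (p1 n, p2 n).
Proof. unfold p1, p2. now destruct (cunpair n). Qed.

Lemma cpair_ge_add (a b : nat) : a + b <= cpair a b.
Proof.
  unfold cpair.
  assert (a + b <= (a + b) * (a + b + 1) / 2) by (apply Nat.div_le_lower_bound; nia). lia.
Qed.

Lemma cpair_exists (n : nat) : exists a b, n = cpair a b.
Proof. exists (p1 n), (p2 n). now rewrite cpair_cunpair. Qed.

Global Opaque cpair p1 p2 cunpair.

Global Hint Rewrite p1_cpair p2_cpair cunpair_cpair : pairs.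

(** Induction on the fuel alone suffices: every call made by [eval] costs one unit, also when
    [CPrimRec] or [CMin] calls itself. *)
Lemma eval_mono (t t' : nat) (c : code) (x y : nat) :
  t <= t' -> eval t c x = Some y -> eval t' c x = Some y.
Proof.
  revert t' c x y. induction t as [|t IH]; intros t' c x y Ht; [discriminate|].
  destruct t' as [|t']; [lia|].
  assert (IH' : forall c x y, eval t c x = Some y -> eval t' c x = Some y)
    by (intros; apply IH; [lia|assumption]).
  clear IH. destruct c; cbn [eval]; auto.
  - destruct (eval t c2 x) as [a|] eqn:E; [|discriminate].
    rewrite (IH' _ _ _ E). apply IH'.
  - destruct (eval t c1 x) as [a|] eqn:E1; [|discriminate].
    destruct (eval t c2 x) as [b|] eqn:E2; [|discriminate].
    now rewrite (IH' _ _ _ E1), (IH' _ _ _ E2).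
  - destruct (cunpair x) as [a [|k]]; [apply IH'|].
    destruct (eval t (CPrimRec c1 c2) (cpair a k)) as [r|] eqn:E; [|discriminate].
    rewrite (IH' _ _ _ E). apply IH'.
  - destruct (cunpair x) as [a k].
    destruct (eval t c (cpair a k)) as [[|r]|] eqn:E; [| |discriminate];
      rewrite (IH' _ _ _ E); auto.
Qed.

Definition evals (c : code) (x y : nat) : Prop := exists t, eval t c x = Some y.

Lemma evals_det (c : code) (x y y' : nat) : evals c x y -> evals c x y' -> y = y'.
Proof.
  intros [t H] [t' H'].
  apply (eval_mono t (max t t')) in H; [|lia].
  apply (eval_mono t' (max t t')) in H'; [|lia].
  congruence.
Qed.

Lemma evals_comp (f g : code) (x y z : nat) :
  evals g x y -> evals f y z -> evals (CComp f g) x z.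
Proof.
  intros [t H] [t' H']. exists (S (max t t')). cbn.
  rewrite (eval_mono t _ _ _ y); [|lia|assumption].
  apply (eval_mono t'); [lia|assumption].
Qed.

Lemma evals_pair (f g : code) (x y z : nat) :
  evals f x y -> evals g x z -> evals (CPair f g) x (cpair y z).
Proof.
  intros [t H] [t' H']. exists (S (max t t')). cbn.
  rewrite (eval_mono t _ f _ y); [|lia|assumption].
  rewrite (eval_mono t' _ g _ z); [|lia|assumption]. reflexivity.
Qed.

Lemma evals_rec_0 (f g : code) (a y : nat) :
  evals f a y -> evals (CPrimRec f g) (cpair a 0) y.
Proof. intros [t H]. exists (S t). cbn. now rewrite cunpair_cpair. Qed.

Lemma evals_rec_S (f g : code) (a k r y : nat) :
  evals (CPrimRec f g) (cpair a k) r -> evals g (cpair a (cpair k r)) y ->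
  evals (CPrimRec f g) (cpair a (S k)) y.
Proof.
  intros [t H] [t' H']. exists (S (max t t')). cbn. rewrite cunpair_cpair.
  rewrite (eval_mono t _ _ _ r); [|lia|assumption].
  apply (eval_mono t'); [lia|assumption].
Qed.

Lemma evals_min_0 (f : code) (x : nat) :
  evals f x 0 -> evals (CMin f) x (p2 x).
Proof.
  intros [t H]. exists (S t). cbn. rewrite cunpair_p1_p2, cpair_cunpair, H. reflexivity.
Qed.

Lemma evals_min_S (f : code) (x r y : nat) :
  evals f x (S r) -> evals (CMin f) (cpair (p1 x) (S (p2 x))) y -> evals (CMin f) x y.
Proof.
  intros [t H] [t' H']. exists (S (max t t')).
  cbn [eval]. rewrite cunpair_p1_p2, cpair_cunpair.
  rewrite (eval_mono t _ _ _ (S r)); [|lia|assumption].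
  apply (eval_mono t'); [lia|assumption].
Qed.

Lemma evals_zero (x : nat) : evals CZero x 0.
Proof. now exists 1. Qed.
Lemma evals_succ (x : nat) : evals CSucc x (S x).
Proof. now exists 1. Qed.
Lemma evals_id (x : nat) : evals CId x x.
Proof. now exists 1. Qed.
Lemma evals_fst (x : nat) : evals CFst x (p1 x).
Proof. now exists 1. Qed.
Lemma evals_snd (x : nat) : evals CSnd x (p2 x).
Proof. now exists 1. Qed.

Lemma computable_ext (f g : nat -> nat) :
  (forall x, f x = g x) -> computable f -> computable g.
Proof. intros E [c H]. exists c. intros x. rewrite <- E. apply H. Qed.

Lemma computable_id : computable (fun x => x).
Proof. exists CId. exact evals_id. Qed.

Lemma computable_comp (f g : nat -> nat) :
  computable f -> computable g -> computable (fun x => f (g x)).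
Proof.
  intros [c Hc] [d Hd]. exists (CComp c d). intros x.
  exact (evals_comp _ _ _ _ _ (Hd x) (Hc (g x))).
Qed.

Lemma computable_S (f : nat -> nat) : computable f -> computable (fun x => S (f x)).
Proof. apply (computable_comp S). exists CSucc. exact evals_succ. Qed.

Lemma computable_p1 (f : nat -> nat) : computable f -> computable (fun x => p1 (f x)).
Proof. apply (computable_comp p1). exists CFst. exact evals_fst. Qed.

Lemma computable_p2 (f : nat -> nat) : computable f -> computable (fun x => p2 (f x)).
Proof. apply (computable_comp p2). exists CSnd. exact evals_snd. Qed.

Lemma computable_const (n : nat) : computable (fun _ => n).
Proof.
  induction n as [|n IH]; [exists CZero; exact evals_zero|now apply computable_S].
Qed.

Lemma computable_cpair (f g : nat -> nat) :
  computable f -> computable g -> computable (fun x => cpair (f x) (g x)).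
Proof.
  intros [c Hc] [d Hd]. exists (CPair c d). intros x.
  exact (evals_pair _ _ _ _ _ (Hc x) (Hd x)).
Qed.

(** [CPrimRec] recurses on the second component with the first as a parameter, so pairing [x] with
    [k x] keeps the whole input available at every round. *)
Lemma computable_rec (b k : nat -> nat) (s : nat -> nat -> nat -> nat) :
  computable b -> computable k ->
  computable (fun z => s (p1 z) (p1 (p2 z)) (p2 (p2 z))) ->
  computable (fun x => nat_rect (fun _ => nat) (b x) (fun i r => s x i r) (k x)).
Proof.
  intros [cb Hb] Hk [cs Hs].
  apply (computable_ext (fun x => (fun z => nat_rect (fun _ => nat) (b (p1 z))
     (fun i r => s (p1 z) i r) (p2 z)) (cpair x (k x)))).
  { intros x. now autorewrite with pairs. }
  apply (computable_comp (fun z => nat_rect (fun _ => nat) (b (p1 z))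
     (fun i r => s (p1 z) i r) (p2 z))); [|now apply computable_cpair; [apply computable_id|]].
  exists (CPrimRec cb cs). intros z. destruct (cpair_exists z) as (a & n & ->).
  autorewrite with pairs. change (evals (CPrimRec cb cs) (cpair a n)
    (nat_rect (fun _ => nat) (b a) (fun i r => s a i r) n)).
  induction n as [|n IH].
  - apply evals_rec_0, Hb.
  - apply (evals_rec_S _ _ _ _ _ _ IH). simpl.
    specialize (Hs (cpair a (cpair n (nat_rect (fun _ => nat) (b a) (fun i r => s a i r) n)))).
    cbv beta in Hs. autorewrite with pairs in Hs. exact Hs.
Qed.

Definition ifz (n a b : nat) : nat := match n with 0 => a | S _ => b end.

Lemma computable_ifz (n a b : nat -> nat) :
  computable n -> computable a -> computable b ->
  computable (fun x => ifz (n x) (a x) (b x)).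
Proof.
  intros Hn Ha Hb.
  apply (computable_ext (fun x => nat_rect (fun _ => nat) (a x) (fun i r => b x) (n x))).
  { intros x. now destruct (n x). }
  apply (computable_rec a n (fun x i r => b x)); auto.
  apply (computable_comp b); auto. apply computable_p1, computable_id.
Qed.

Lemma computable_pred (f : nat -> nat) : computable f -> computable (fun x => pred (f x)).
Proof.
  intros Hf.
  apply (computable_ext (fun x => nat_rect (fun _ => nat) 0 (fun i r => i) (f x))).
  { intros x. now destruct (f x). }
  apply (computable_rec (fun _ => 0) f (fun x i r => i)); auto using computable_const.
  apply computable_p1, computable_p2, computable_id.
Qed.

Lemma computable_add (f g : nat -> nat) :
  computable f -> computable g -> computable (fun x => f x + g x).
Proof.
  intros Hf Hg.
  apply (computable_ext (fun x => nat_rect (fun _ => nat) (g x) (fun i r => S r) (f x))).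
  { intros x. induction (f x); simpl; auto. }
  apply (computable_rec g f (fun x i r => S r)); auto.
  apply computable_S, computable_p2, computable_p2, computable_id.
Qed.

Lemma computable_sub (f g : nat -> nat) :
  computable f -> computable g -> computable (fun x => f x - g x).
Proof.
  intros Hf Hg.
  apply (computable_ext (fun x => nat_rect (fun _ => nat) (f x) (fun i r => pred r) (g x))).
  { intros x. induction (g x) as [|n IH]; simpl; [lia|]. rewrite IH. lia. }
  apply (computable_rec f g (fun x i r => pred r)); auto.
  apply computable_pred, computable_p2, computable_p2, computable_id.
Qed.

Lemma computable_mul (f g : nat -> nat) :
  computable f -> computable g -> computable (fun x => f x * g x).
Proof.
  intros Hf Hg.
  apply (computable_ext (fun x => nat_rect (fun _ => nat) 0 (fun i r => g x + r) (f x))).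
  { intros x. induction (f x) as [|n IH]; simpl; [lia|]. now rewrite IH. }
  apply (computable_rec (fun _ => 0) f (fun x i r => g x + r)); auto using computable_const.
  apply computable_add; [apply (computable_comp g); auto|];
    repeat (apply computable_p1 || apply computable_p2); apply computable_id.
Qed.

Lemma computable_pow2 (f : nat -> nat) :
  computable f -> computable (fun x => 2 ^ f x).
Proof.
  intros Hf.
  apply (computable_ext (fun x => nat_rect (fun _ => nat) 1 (fun i r => r + r) (f x))).
  { intros x. induction (f x) as [|n IH]; simpl; [lia|]. rewrite IH. lia. }
  apply (computable_rec (fun _ => 1) f (fun x i r => r + r)); auto using computable_const.
  apply computable_add; apply computable_p2, computable_p2, computable_id.
Qed.

Lemma computable_iter (n b : nat -> nat) (s : nat -> nat) :
  computable n -> computable b -> computable s ->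
  computable (fun x => Nat.iter (n x) s (b x)).
Proof.
  intros Hn Hb Hs. apply (computable_rec b n (fun x i r => s r)); auto.
  apply (computable_comp s); auto. apply computable_p2, computable_p2, computable_id.
Qed.

(** Decidable conditions are coded by numbers that vanish when the condition holds. Then addition is
    conjunction, multiplication is disjunction, [bsum] is a bounded universal quantifier and [bprod]
    a bounded existential one. *)
Definition bsum (n : nat) (F : nat -> nat) : nat :=
  nat_rect (fun _ => nat) 0 (fun i r => r + F i) n.
Lemma bsum_S (n : nat) (F : nat -> nat) : bsum (S n) F = bsum n F + F n.
Proof. reflexivity. Qed.

Definition bprod (n : nat) (F : nat -> nat) : nat :=
  nat_rect (fun _ => nat) 1 (fun i r => r * F i) n.

Lemma computable_bsum (n : nat -> nat) (F : nat -> nat -> nat) :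
  computable n -> computable (fun z => F (p1 z) (p2 z)) ->
  computable (fun x => bsum (n x) (fun i => F x i)).
Proof.
  intros Hn HF.
  apply (computable_rec (fun _ => 0) n (fun x i r => r + F x i)); auto using computable_const.
  apply computable_add; [apply computable_p2, computable_p2, computable_id|].
  apply (computable_ext (fun z => (fun z => F (p1 z) (p2 z)) (cpair (p1 z) (p1 (p2 z))))).
  { intros z. now autorewrite with pairs. }
  apply (computable_comp _ _ HF).
  apply computable_cpair; repeat (apply computable_p1 || apply computable_p2);
    apply computable_id.
Qed.

Lemma computable_bprod (n : nat -> nat) (F : nat -> nat -> nat) :
  computable n -> computable (fun z => F (p1 z) (p2 z)) ->
  computable (fun x => bprod (n x) (fun i => F x i)).
Proof.
  intros Hn HF.
  apply (computable_rec (fun _ => 1) n (fun x i r => r * F x i)); auto using computable_const.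
  apply computable_mul; [apply computable_p2, computable_p2, computable_id|].
  apply (computable_ext (fun z => (fun z => F (p1 z) (p2 z)) (cpair (p1 z) (p1 (p2 z))))).
  { intros z. now autorewrite with pairs. }
  apply (computable_comp _ _ HF).
  apply computable_cpair; repeat (apply computable_p1 || apply computable_p2);
    apply computable_id.
Qed.

(* Syntactic matching: plain [apply] would unfold [Nat.modulo], [Nat.div], etc. *)
Ltac comp_step :=
  lazymatch goal with
  | H : computable ?f |- computable ?f => exact H
  | |- computable (fun x => x) => apply computable_id
  | |- computable (fun _ => ?n) => exact (computable_const n)
  | |- computable p1 => apply (computable_p1 (fun x => x)), computable_id
  | |- computable p2 => apply (computable_p2 (fun x => x)), computable_id
  | |- computable (fun x => p1 (@?f x)) => apply (computable_p1 f)
  | |- computable (fun x => p2 (@?f x)) => apply (computable_p2 f)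
  | |- computable (fun x => S (@?f x)) => apply (computable_S f)
  | |- computable (fun x => pred (@?f x)) => apply (computable_pred f)
  | |- computable (fun x => 2 ^ (@?f x)) => apply (computable_pow2 f)
  | |- computable (fun x => cpair (@?f x) (@?g x)) => apply (computable_cpair f g)
  | |- computable (fun x => @?f x + @?g x) => apply (computable_add f g)
  | |- computable (fun x => @?f x - @?g x) => apply (computable_sub f g)
  | |- computable (fun x => @?f x * @?g x) => apply (computable_mul f g)
  | |- computable (fun x => ifz (@?f x) (@?g x) (@?h x)) => apply (computable_ifz f g h)
  | |- computable (fun x => bsum (@?n x) (fun i => @?F x i)) => apply (computable_bsum n F)
  | |- computable (fun x => bprod (@?n x) (fun i => @?F x i)) => apply (computable_bprod n F)
  | H : computable ?f |- computable (fun x => ?f (@?g x)) => apply (computable_comp f g H)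
  end; cbv beta.

Ltac comp_base := repeat comp_step.

Lemma bsum_eq_0 (n : nat) (F : nat -> nat) : bsum n F = 0 <-> forall i, i < n -> F i = 0.
Proof.
  induction n as [|n IH]; simpl; [split; [lia|reflexivity]|].
  rewrite Nat.eq_add_0, IH. split.
  - intros [H1 H2] i Hi. destruct (Nat.eq_dec i n) as [->|]; [assumption|apply H1; lia].
  - intros H. split; [intros i Hi; apply H; lia|apply H; lia].
Qed.

Lemma bprod_eq_0 (n : nat) (F : nat -> nat) : bprod n F = 0 <-> exists i, i < n /\ F i = 0.
Proof.
  induction n as [|n IH]; simpl.
  - split; [lia|intros (i & Hi & _); lia].
  - rewrite Nat.eq_mul_0, IH. split.
    + intros [(i & Hi & H)|H]; [exists i|exists n]; split; auto; lia.
    + intros (i & Hi & H). destruct (Nat.eq_dec i n) as [->|]; [now right|].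
      left. exists i. split; auto; lia.
Qed.

Lemma bsum_ext (n : nat) (F G : nat -> nat) :
  (forall i, i < n -> F i = G i) -> bsum n F = bsum n G.
Proof.
  intros H. induction n as [|n IH]; simpl; [reflexivity|].
  rewrite IH, H; auto.
Qed.

(** The i-th summand is 1 if (i+1)(b+1) <= a and 0 otherwise, so the sum counts the positive
    multiples of b+1 up to a. *)
Lemma div_bsum (a b : nat) : a / S b = bsum a (fun i => 1 - (S i * S b - a)).
Proof.
  assert (H : forall n, n <= a ->
    bsum n (fun i => 1 - (S i * S b - a)) = min n (a / S b)).
  { induction n as [|n IH]; intros Hn; [reflexivity|].
    rewrite bsum_S, IH by lia.
    destruct (le_lt_dec (S n * S b) a) as [Hl|Hl].
    - assert (S n <= a / S b) by (apply Nat.div_le_lower_bound; lia). lia.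
    - assert (a / S b < S n) by (apply Nat.Div0.div_lt_upper_bound; lia). lia. }
  rewrite H by lia. symmetry. apply Nat.min_r. apply Nat.Div0.div_le_upper_bound. nia.
Qed.

Lemma computable_div (f g : nat -> nat) :
  computable f -> computable g -> computable (fun x => f x / g x).
Proof.
  intros Hf Hg.
  (* The separate case reproduces the convention a / 0 = 0. *)
  apply (computable_ext (fun x => ifz (g x) 0
    (bsum (f x) (fun i => 1 - (S i * g x - f x))))).
  { intros x. destruct (g x); simpl ifz; [reflexivity|now rewrite div_bsum]. }
  comp_base.
Qed.

Lemma computable_mod (f g : nat -> nat) :
  computable f -> computable g -> computable (fun x => f x mod g x).
Proof.
  intros Hf Hg.
  apply (computable_ext (fun x => f x - g x * (f x / g x))).
  { intros x. symmetry. apply Nat.Div0.mod_eq. }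
  comp_base. now apply computable_div.
Qed.

Ltac comp :=
  repeat first
    [ comp_step
    | lazymatch goal with
      | |- computable (fun x => @?f x / @?g x) => apply (computable_div f g)
      | |- computable (fun x => @?f x mod @?g x) => apply (computable_mod f g)
      end; cbv beta ].

(** * A universal machine *)

Lemma p1_le (n : nat) : p1 n <= n.
Proof.
  destruct (cpair_exists n) as (a & b & ->). autorewrite with pairs.
  pose proof (cpair_ge_add a b). lia.
Qed.

Lemma p2_le (n : nat) : p2 n <= n.
Proof.
  destruct (cpair_exists n) as (a & b & ->). autorewrite with pairs.
  pose proof (cpair_ge_add a b). lia.
Qed.

(** For n > 0 the recursive calls are at n / 9 or at its projections, all less than n, so fuel above
    n never runs out; at n = 0 the tag alone gives [CZero]. *)
Lemma decode_aux_fuel (f f' n : nat) :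
  n < f -> n < f' -> decode_aux f n = decode_aux f' n.
Proof.
  revert f' n. induction f as [|f IH]; intros f' n H H'; [lia|].
  destruct f' as [|f']; [lia|]. cbn [decode_aux]. rewrite cunpair_p1_p2.
  pose proof (p1_le (n / 9)). pose proof (p2_le (n / 9)).
  destruct (Nat.eq_dec n 0) as [->|Hn]; [reflexivity|].
  assert (n / 9 < n) by (apply Nat.div_lt; lia).
  rewrite (IH f' (p1 (n / 9))), (IH f' (p2 (n / 9))), (IH f' (n / 9)) by lia.
  reflexivity.
Qed.

Lemma decode_eq (e : nat) :
  decode e =
  let m := e / 9 in
  match e mod 9 with
  | 0 => CZero
  | 1 => CSucc
  | 2 => CId
  | 3 => CFst
  | 4 => CSnd
  | 5 => CComp (decode (p1 m)) (decode (p2 m))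
  | 6 => CPair (decode (p1 m)) (decode (p2 m))
  | 7 => CPrimRec (decode (p1 m)) (decode (p2 m))
  | _ => CMin (decode m)
  end.
Proof.
  destruct (Nat.eq_dec e 0) as [->|Hn]; [reflexivity|].
  unfold decode at 1. cbn [decode_aux]. rewrite cunpair_p1_p2. unfold decode.
  pose proof (p1_le (e / 9)). pose proof (p2_le (e / 9)).
  assert (e / 9 < e) by (apply Nat.div_lt; lia).
  rewrite (decode_aux_fuel e (S (p1 (e / 9)))), (decode_aux_fuel e (S (p2 (e / 9)))),
    (decode_aux_fuel e (S (e / 9))) by lia. reflexivity.
Qed.

Lemma decode_tag (m r : nat) : r < 9 -> (m * 9 + r) / 9 = m /\ (m * 9 + r) mod 9 = r.
Proof.
  intros Hr. split.
  - rewrite Nat.div_add_l by lia. rewrite Nat.div_small; lia.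
  - rewrite Nat.add_comm, Nat.Div0.mod_add. now apply Nat.mod_small.
Qed.

Definition comp_number (i j : nat) : nat := cpair i j * 9 + 5.
Definition pair_number (i j : nat) : nat := cpair i j * 9 + 6.

Lemma decode_comp_number (i j : nat) :
  decode (comp_number i j) = CComp (decode i) (decode j).
Proof.
  rewrite decode_eq. unfold comp_number.
  destruct (decode_tag (cpair i j) 5 ltac:(lia)) as [-> ->].
  cbv zeta. now autorewrite with pairs.
Qed.

Lemma decode_pair_number (i j : nat) :
  decode (pair_number i j) = CPair (decode i) (decode j).
Proof.
  rewrite decode_eq. unfold pair_number.
  destruct (decode_tag (cpair i j) 6 ltac:(lia)) as [-> ->].
  cbv zeta. now autorewrite with pairs.
Qed.

Lemma decode_surjective (c : code) : exists e, decode e = c.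
Proof.
  induction c as [| | | | |f [i Hi] g [j Hj]|f [i Hi] g [j Hj]|f [i Hi] g [j Hj]|f [i Hi]].
  - now exists 0.
  - now exists 1.
  - now exists 2.
  - now exists 3.
  - now exists 4.
  - exists (comp_number i j). now rewrite decode_comp_number, Hi, Hj.
  - exists (pair_number i j). now rewrite decode_pair_number, Hi, Hj.
  - exists (cpair i j * 9 + 7). rewrite decode_eq.
    destruct (decode_tag (cpair i j) 7 ltac:(lia)) as [-> ->].
    cbv zeta. autorewrite with pairs. now rewrite Hi, Hj.
  - exists (i * 9 + 8). rewrite decode_eq.
    destruct (decode_tag i 8 ltac:(lia)) as [-> ->]. cbv zeta. now rewrite Hi.
Qed.

(** Here 0 is the number of [CZero] and 1 that of [CSucc]. *)
Definition const_number (n : nat) : nat := nat_rect (fun _ => nat) 0 (fun _ r => comp_number 1 r) n.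

Lemma evals_const_number (n x : nat) : evals (decode (const_number n)) x n.
Proof.
  induction n as [|n IH]; [apply evals_zero|].
  simpl. rewrite decode_comp_number. apply (evals_comp _ _ _ n); [assumption|apply evals_succ].
Qed.

Lemma computable_const_number : computable const_number.
Proof.
  apply (computable_rec (fun _ => 0) (fun x => x) (fun x i r => comp_number 1 r));
    unfold comp_number; comp.
Qed.

(** Evaluation is simulated by a stack machine. Tag 0 marks a configuration about to evaluate code
    number [e] at [x], tag 1 one that hands [y] back to the stack [K]. *)
Definition run_config (e x K : nat) : nat := cpair 0 (cpair e (cpair x K)).
Definition ret_config (y K : nat) : nat := cpair 1 (cpair y K).
(* A stack is 0 when empty, and the successor of a pair (top frame, rest) otherwise. *)
Definition push (tag u v K : nat) : nat := S (cpair (cpair tag (cpair u v)) K).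

(** Frame tags name the pending work: 0 the outer function of a composition, 1 the second component
    of a pair, 2 the step function of a recursion, 3 the zero test of a minimization, 4 the pairing
    with a first component already computed. *)
Definition step_run (e x K : nat) : nat :=
  let t := e mod 9 in let m := e / 9 in
  ifz t (ret_config 0 K)
  (ifz (t - 1) (ret_config (S x) K)
  (ifz (t - 2) (ret_config x K)
  (ifz (t - 3) (ret_config (p1 x) K)
  (ifz (t - 4) (ret_config (p2 x) K)
  (ifz (t - 5) (run_config (p2 m) x (push 0 0 (p1 m) K))
  (ifz (t - 6) (run_config (p1 m) x (push 1 (p2 m) x K))
  (ifz (t - 7)
     (ifz (p2 x) (run_config (p1 m) (p1 x) K)
        (run_config e (cpair (p1 x) (pred (p2 x)))
           (push 2 (p2 m) (cpair (p1 x) (pred (p2 x))) K)))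
     (run_config m x (push 3 e x K))))))))).

(** With an empty stack the configuration is a fixed point, so that halting persists. *)
Definition step_ret (y K : nat) : nat :=
  let fr := p1 (pred K) in let K' := p2 (pred K) in
  let t := p1 fr in let u := p1 (p2 fr) in let v := p2 (p2 fr) in
  ifz K (ret_config y 0)
  (ifz t (run_config v y K')
  (ifz (t - 1) (run_config u v (push 4 y 0 K'))
  (ifz (t - 2) (run_config u (cpair (p1 v) (cpair (p2 v) y)) K')
  (ifz (t - 3)
     (ifz y (ret_config (p2 v) K') (run_config u (cpair (p1 v) (S (p2 v))) K'))
     (ret_config (cpair u y) K'))))).

Definition step (z : nat) : nat :=
  ifz (p1 z) (step_run (p1 (p2 z)) (p1 (p2 (p2 z))) (p2 (p2 (p2 z))))
    (step_ret (p1 (p2 z)) (p2 (p2 z))).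

Lemma computable_step : computable step.
Proof.
  unfold step, step_run, step_ret, run_config, ret_config, push. cbv zeta.
  comp.
Qed.

Lemma step_run_config (e x K : nat) : step (run_config e x K) = step_run e x K.
Proof. unfold step, run_config. now autorewrite with pairs. Qed.

Lemma step_run_config_cases (e x K : nat) :
  let m := e / 9 in
  step (run_config e x K) =
  match decode e with
  | CZero => ret_config 0 K
  | CSucc => ret_config (S x) K
  | CId => ret_config x K
  | CFst => ret_config (p1 x) K
  | CSnd => ret_config (p2 x) K
  | CComp _ _ => run_config (p2 m) x (push 0 0 (p1 m) K)
  | CPair _ _ => run_config (p1 m) x (push 1 (p2 m) x K)
  | CPrimRec _ _ =>
     ifz (p2 x) (run_config (p1 m) (p1 x) K)
        (run_config e (cpair (p1 x) (pred (p2 x)))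
           (push 2 (p2 m) (cpair (p1 x) (pred (p2 x))) K))
  | CMin _ => run_config m x (push 3 e x K)
  end.
Proof.
  cbv zeta. rewrite step_run_config, decode_eq. unfold step_run. cbv zeta.
  assert (H : e mod 9 < 9) by (apply Nat.mod_upper_bound; lia).
  destruct (e mod 9) as [|[|[|[|[|[|[|[|[|t]]]]]]]]]; try reflexivity; lia.
Qed.

Lemma decode_subcodes (e : nat) :
  let m := e / 9 in
  match decode e with
  | CComp f g | CPair f g | CPrimRec f g => f = decode (p1 m) /\ g = decode (p2 m)
  | CMin f => f = decode m
  | _ => True
  end.
Proof.
  cbv zeta. rewrite decode_eq. cbv zeta.
  destruct (e mod 9) as [|[|[|[|[|[|[|[|[|t]]]]]]]]]; auto.
Qed.

Lemma step_ret_config (y K : nat) : step (ret_config y K) = step_ret y K.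
Proof. unfold step, ret_config. now autorewrite with pairs. Qed.

Lemma step_push (y t u v K : nat) :
  step (ret_config y (push t u v K)) =
  match t with
  | 0 => run_config v y K
  | 1 => run_config u v (push 4 y 0 K)
  | 2 => run_config u (cpair (p1 v) (cpair (p2 v) y)) K
  | 3 => ifz y (ret_config (p2 v) K) (run_config u (cpair (p1 v) (S (p2 v))) K)
  | _ => ret_config (cpair u y) K
  end.
Proof.
  rewrite step_ret_config. unfold step_ret, push. cbn [ifz pred].
  autorewrite with pairs. now destruct t as [|[|[|[|t]]]].
Qed.

(** * Correctness of the universal machine *)

Definition reach (z z' : nat) : Prop := exists n, Nat.iter n step z = z'.

Lemma iter_swap (n z : nat) : Nat.iter n step (step z) = step (Nat.iter n step z).
Proof. induction n as [|n IH]; simpl; [reflexivity|now rewrite IH]. Qed.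

Lemma iter_add (m n z : nat) : Nat.iter (m + n) step z = Nat.iter n step (Nat.iter m step z).
Proof. induction m as [|m IH]; simpl; [reflexivity|]. now rewrite IH, iter_swap. Qed.

Lemma reach_trans (x y z : nat) : reach x y -> reach y z -> reach x z.
Proof. intros [m <-] [n <-]. exists (m + n). apply iter_add. Qed.

Lemma reach_step (x z : nat) : reach (step x) z -> reach x z.
Proof. intros [n <-]. exists (S n). simpl. symmetry. apply iter_swap. Qed.

Lemma reach_refl (x : nat) : reach x x.
Proof. now exists 0. Qed.

(** The stack is arbitrary so that the induction hypothesis covers subcomputations, which start with
    a frame pushed on top. *)
Lemma eval_reach (t e x y K : nat) :
  eval t (decode e) x = Some y -> reach (run_config e x K) (ret_config y K).
Proof.
  revert e x y K. induction t as [|t IH]; intros e x y K; [discriminate|].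
  pose proof (step_run_config_cases e x K) as Hs. pose proof (decode_subcodes e) as Hd.
  cbv zeta in Hs, Hd. destruct (decode e) eqn:He; cbn [eval]; intros H;
    apply reach_step; rewrite Hs; try (injection H as <-; apply reach_refl).
  - destruct Hd as [-> ->].
    destruct (eval t (decode (p2 (e / 9))) x) as [a|] eqn:E; [|discriminate].
    eapply reach_trans; [eapply IH, E|]. apply reach_step. rewrite step_push.
    now apply IH.
  - destruct Hd as [-> ->].
    destruct (eval t (decode (p1 (e / 9))) x) as [a|] eqn:E1; [|discriminate].
    destruct (eval t (decode (p2 (e / 9))) x) as [b|] eqn:E2; [|discriminate].
    injection H as <-.
    eapply reach_trans; [eapply IH, E1|]. apply reach_step. rewrite step_push.
    eapply reach_trans; [eapply IH, E2|]. apply reach_step. rewrite step_push.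
    apply reach_refl.
  - rewrite cunpair_p1_p2 in H.
    destruct (p2 x) as [|k] eqn:Ek; cbn [ifz pred].
    + destruct Hd as [-> ->]. now apply IH.
    (* The recursive call runs the same code, and the machine stays at the same number [e]. *)
    + rewrite <- He in H.
      destruct (eval t (decode e) (cpair (p1 x) k)) as [r|] eqn:E; [|discriminate].
      eapply reach_trans; [eapply IH, E|]. apply reach_step. rewrite step_push.
      autorewrite with pairs. destruct Hd as [-> ->]. now apply IH.
  - rewrite cunpair_p1_p2, cpair_cunpair in H. subst c.
    destruct (eval t (decode (e / 9)) x) as [[|r]|] eqn:E; [| |discriminate].
    + injection H as <-.
      eapply reach_trans; [eapply IH, E|]. apply reach_step. rewrite step_push.
      apply reach_refl.
    + eapply reach_trans; [eapply IH, E|]. apply reach_step. rewrite step_push.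
      cbn [ifz]. apply IH. rewrite He. exact H.
Qed.

Definition halted (z : nat) : Prop := p1 z <> 0 /\ p2 (p2 z) = 0.

Lemma halted_run_config (e x K : nat) : ~ halted (run_config e x K).
Proof. unfold halted, run_config. autorewrite with pairs. tauto. Qed.

Lemma halted_push (y t u v K : nat) : ~ halted (ret_config y (push t u v K)).
Proof. unfold halted, ret_config, push. autorewrite with pairs. intros [_ H]. discriminate. Qed.

Lemma halted_step (z : nat) : halted z -> halted (step z).
Proof.
  intros [H1 H2]. unfold step. destruct (p1 z); [easy|]. cbn [ifz].
  rewrite H2. unfold step_ret. cbn [ifz]. unfold halted, ret_config.
  autorewrite with pairs. auto.
Qed.

Lemma halted_iter_mono (m n z : nat) :
  m <= n -> halted (Nat.iter m step z) -> halted (Nat.iter n step z).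
Proof.
  intros Hmn H. induction Hmn as [|n Hmn IH]; [assumption|]. simpl. now apply halted_step.
Qed.

Lemma halted_iter_inv (n z : nat) :
  ~ halted z -> halted (Nat.iter n step z) ->
  exists n', n = S n' /\ halted (Nat.iter n' step (step z)).
Proof.
  destruct n as [|n]; simpl; [tauto|]. intros _ H. exists n. now rewrite iter_swap.
Qed.

(** Converse of [eval_reach], by strong induction on the number of steps: the stack [K] is consulted
    only once a value is returned to it, so a halting run passes through such a return. The count
    [m] of remaining steps lets the hypothesis be applied again to the rest of the run. *)
Lemma halted_evals (n e x K : nat) :
  halted (Nat.iter n step (run_config e x K)) ->
  exists m y, m <= n /\ evals (decode e) x y /\ halted (Nat.iter m step (ret_config y K)).
Proof.
  revert e x K. induction n as [n IH] using lt_wf_ind. intros e x K H.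
  apply halted_iter_inv in H; [|apply halted_run_config]. destruct H as (k & -> & H).
  pose proof (step_run_config_cases e x K) as Hs. pose proof (decode_subcodes e) as Hd.
  cbv zeta in Hs, Hd. rewrite Hs in H. clear Hs.
  (* A return to a nonempty stack has not halted, so at least one more step follows and the
     remaining count drops strictly. *)
  assert (IH' : forall k' e x t u v K, k' <= k ->
    halted (Nat.iter k' step (run_config e x (push t u v K))) ->
    exists m y, m < k' /\ evals (decode e) x y /\
      halted (Nat.iter m step (step (ret_config y (push t u v K))))).
  { intros k' e' x' t u v K' Hk H'. apply IH in H'; [|lia].
    destruct H' as (m & y & Hm & He & H').
    apply halted_iter_inv in H'; [|apply halted_push]. destruct H' as (m' & -> & H').
    exists m', y. auto. }
  destruct (decode e) eqn:He.
  - exists k, 0. auto using evals_zero.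
  - exists k, (S x). auto using evals_succ.
  - exists k, x. auto using evals_id.
  - exists k, (p1 x). auto using evals_fst.
  - exists k, (p2 x). auto using evals_snd.
  - destruct Hd as [-> ->]. apply IH' in H; [|lia]. destruct H as (m & y & Hm & Hy & H).
    rewrite step_push in H. apply IH in H; [|lia]. destruct H as (m' & y' & Hm' & Hy' & H).
    exists m', y'. split; [lia|]. eauto using evals_comp.
  - destruct Hd as [-> ->]. apply IH' in H; [|lia]. destruct H as (m & y & Hm & Hy & H).
    rewrite step_push in H. apply IH' in H; [|lia]. destruct H as (m' & y' & Hm' & Hy' & H).
    rewrite step_push in H. exists m', (cpair y y'). split; [lia|].
    eauto using evals_pair.
  - destruct (p2 x) as [|j] eqn:Ej; cbn [ifz pred] in H.
    + destruct Hd as [-> ->]. apply IH in H; [|lia]. destruct H as (m & y & Hm & Hy & H).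
      exists m, y. split; [lia|]. split; [|assumption].
      rewrite <- (cpair_cunpair x), Ej. now apply evals_rec_0.
    + apply IH' in H; [|lia]. destruct H as (m & y & Hm & Hy & H).
      rewrite step_push in H. autorewrite with pairs in H. rewrite He in Hy.
      destruct Hd as [-> ->]. apply IH in H; [|lia]. destruct H as (m' & y' & Hm' & Hy' & H).
      exists m', y'. split; [lia|]. split; [|assumption].
      rewrite <- (cpair_cunpair x), Ej. eauto using evals_rec_S.
  - subst c. apply IH' in H; [|lia]. destruct H as (m & y & Hm & Hy & H).
    rewrite step_push in H. destruct y as [|y]; cbn [ifz] in H.
    + exists m, (p2 x). split; [lia|]. eauto using evals_min_0.
    + apply IH in H; [|lia]. destruct H as (m' & y' & Hm' & Hy' & H). rewrite He in Hy'.
      exists m', y'. split; [lia|]. eauto using evals_min_S.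
Qed.

Definition run (k e x : nat) : nat := Nat.iter k step (run_config e x 0).

Lemma halted_run_iff (e x : nat) :
  (exists t, conv_in e t x) <-> (exists k, halted (run k e x)).
Proof.
  split.
  - intros (t & y & H). apply (eval_reach _ _ _ _ 0) in H. destruct H as [k H].
    exists k. unfold run. rewrite H. unfold halted, ret_config. now autorewrite with pairs.
  - intros [k H]. apply halted_evals in H. destruct H as (_ & y & _ & [t H] & _).
    exists t, y. exact H.
Qed.

Definition running (k e x : nat) : nat := (1 - p1 (run k e x)) + p2 (p2 (run k e x)).

Lemma running_eq_0 (k e x : nat) : running k e x = 0 <-> halted (run k e x).
Proof. unfold running, halted. lia. Qed.

Lemma computable_running (k e x : nat -> nat) :
  computable k -> computable e -> computable x ->
  computable (fun z => running (k z) (e z) (x z)).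
Proof.
  intros Hk He Hx. unfold running.
  assert (H : computable (fun z => run (k z) (e z) (x z))).
  { unfold run, run_config. apply (computable_iter k _ step); comp. apply computable_step. }
  comp.
Qed.

(** * Strings, trees and compactness *)

Lemma initial_length (x : nat -> bool) (n : nat) : length (initial x n) = n.
Proof. unfold initial. now rewrite length_map, length_seq. Qed.

Lemma initial_S (x : nat -> bool) (n : nat) : initial x (S n) = initial x n ++ [x n].
Proof. unfold initial. now rewrite seq_S, map_app. Qed.

Lemma firstn_initial (x : nat -> bool) (m n : nat) :
  m <= n -> firstn m (initial x n) = initial x m.
Proof.
  intros H. unfold initial. rewrite firstn_map. f_equal.
  replace n with (m + (n - m)) by lia. rewrite seq_app.
  rewrite firstn_app, length_seq, Nat.sub_diag, firstn_O, app_nil_r.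
  rewrite <- (length_seq m 0) at 1. apply firstn_all.
Qed.

Lemma initial_eq_iff (x y : nat -> bool) (n : nat) :
  initial x n = initial y n <-> forall i, i < n -> x i = y i.
Proof.
  induction n as [|n IH]; [split; [lia|reflexivity]|].
  rewrite !initial_S. split.
  - intros H. apply app_inj_tail in H. destruct H as [H1 H2]. rewrite IH in H1.
    intros i Hi. destruct (Nat.eq_dec i n) as [->|]; [assumption|apply H1; lia].
  - intros H. rewrite (H n) by lia. f_equal. apply IH. auto.
Qed.

Lemma prefix_firstn (r s : list bool) : prefix r s <-> firstn (length r) s = r /\ length r <= length s.
Proof.
  split.
  - intros [u ->]. rewrite firstn_app, firstn_all, Nat.sub_diag, firstn_O, app_nil_r.
    rewrite length_app. split; [reflexivity|lia].
  - intros [H _]. exists (skipn (length r) s). rewrite <- H at 1. symmetry. apply firstn_skipn.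
Qed.

Lemma prefix_firstn_l (n : nat) (s : list bool) : prefix (firstn n s) s.
Proof. exists (skipn n s). symmetry. apply firstn_skipn. Qed.

Lemma prefix_trans (r s t : list bool) : prefix r s -> prefix s t -> prefix r t.
Proof. intros [u ->] [v ->]. exists (u ++ v). now rewrite app_assoc. Qed.

Lemma prefix_initial (r : list bool) (x : nat -> bool) (n : nat) :
  prefix r (initial x n) -> r = initial x (length r) /\ length r <= n.
Proof.
  intros H. apply prefix_firstn in H. rewrite initial_length in H.
  destruct H as [H H']. rewrite firstn_initial in H by assumption. auto.
Qed.

Lemma initial_prefix (x : nat -> bool) (m n : nat) :
  m <= n -> prefix (initial x m) (initial x n).
Proof. intros H. rewrite <- (firstn_initial x m n H). apply prefix_firstn_l. Qed.

Definition downward_closed (T : list bool -> Prop) : Prop :=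
  forall r s, prefix r s -> T s -> T r.

(** Weak König's lemma: follow nodes that have extensions of every length in the tree. *)
Lemma infinite_tree_has_path (G : list bool -> Prop) :
  downward_closed G -> (forall L, exists s, length s = L /\ G s) ->
  exists x, forall n, G (initial x n).
Proof.
  intros Gd Ginf.
  pose (big := fun s => forall L, exists u, length u = L /\ G (s ++ u)).
  assert (Hbig : forall s, big s -> ~ big (s ++ [true]) -> big (s ++ [false])).
  { intros s Hs Ht L.
    apply not_all_ex_not in Ht. destruct Ht as [L1 Ht].
    (* The child [true] has no extension by [L1] bits. So an extension exceeding both [L] and [L1]
       starts with [false], and its truncation serves for [L]. *)
    destruct (Hs (S (max L L1))) as ([|b u] & Hu & HG); [discriminate|].
    injection Hu as Hu.
    assert (Hb : forall k, k <= max L L1 -> length (firstn k u) = k /\ G ((s ++ [b]) ++ firstn k u)).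
    { intros k Hk. split; [rewrite firstn_length_le; lia|].
      apply Gd with (s ++ b :: u); [|assumption].
      exists (skipn k u). rewrite <- !app_assoc. simpl. now rewrite firstn_skipn. }
    destruct b.
    - exfalso. apply Ht. exists (firstn L1 u). apply Hb. lia.
    - exists (firstn L u). apply Hb. lia. }
  pose (next := fun s => if excluded_middle_informative (big (s ++ [true])) then true else false).
  pose (str := fun n => nat_rect (fun _ => list bool) [] (fun _ s => s ++ [next s]) n).
  exists (fun n => next (str n)).
  assert (Hstr : forall n, initial (fun n => next (str n)) n = str n).
  { induction n as [|n IH]; [reflexivity|]. rewrite initial_S, IH. reflexivity. }
  assert (Hb : forall n, big (str n)).
  { induction n as [|n IH]; [exact Ginf|]. simpl. unfold next.
    destruct (excluded_middle_informative (big (str n ++ [true]))); auto. }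
  intros n. rewrite Hstr. destruct (Hb n 0) as ([|b u] & Hu & HG); [|discriminate].
  now rewrite app_nil_r in HG.
Qed.

(** The nodes of [T] without a prefix in [C] form a tree; were it infinite, it would have a path in
    [T] that [C] misses. *)
Lemma compactness (T C : list bool -> Prop) :
  downward_closed T ->
  (forall x, (forall n, T (initial x n)) -> exists n, C (initial x n)) ->
  exists L, forall s, length s = L -> T s -> exists r, C r /\ prefix r s.
Proof.
  intros Td Hcov. apply NNPP. intros Hn.
  destruct (infinite_tree_has_path (fun s => T s /\ forall r, prefix r s -> ~ C r)) as [x Hx].
  - intros r s Hrs [HT HC]. split; [now apply Td with s|].
    intros r' Hr'. apply HC. now apply prefix_trans with r.
  - intros L. apply NNPP. intros HL. apply Hn. exists L. intros s Hs HT.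
    apply NNPP. intros Hr. apply HL. exists s. repeat split; auto.
    intros r Hp HCr. apply Hr. now exists r.
  - destruct (Hcov x) as [n Hnx]; [apply Hx|].
    apply (proj2 (Hx n) (initial x n)); [|assumption]. now apply initial_prefix.
Qed.

Fixpoint all_strings (n : nat) : list (list bool) :=
  match n with
  | 0 => [[]]
  | S n => map (cons true) (all_strings n) ++ map (cons false) (all_strings n)
  end.

Lemma in_all_strings (s : list bool) : In s (all_strings (length s)).
Proof.
  induction s as [|b s IH]; simpl; [auto|]. apply in_or_app.
  destruct b; [left|right]; now apply in_map.
Qed.

(** Finitely many existence statements get one common bound; this serves for indices of cover
    elements, running times and search witnesses. *)
Lemma list_uniform_bound {A : Type} (P : A -> nat -> Prop) (l : list A) :
  (forall a, In a l -> exists i, P a i) ->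
  exists N, forall a, In a l -> exists i, i <= N /\ P a i.
Proof.
  induction l as [|a l IH]; intros H; [exists 0; easy|].
  destruct IH as [N HN]; [intros; apply H; now right|].
  destruct (H a) as [i Hi]; [now left|].
  exists (max i N). intros b [->|Hb].
  - exists i. split; [lia|assumption].
  - destruct (HN b Hb) as (j & Hj & HP). exists j. split; [lia|assumption].
Qed.

(** * Sums over lists and the rounded exponent *)

Definition nsum {A : Type} (f : A -> nat) (l : list A) : nat := list_sum (map f l).

Lemma nsum_cons {A : Type} (f : A -> nat) (a : A) (l : list A) :
  nsum f (a :: l) = f a + nsum f l.
Proof. reflexivity. Qed.

(** This is the floor of s l for s = p/q. *)
Definition weight (p q l : nat) : nat := p * l / q.

Lemma weight_spec (p q l : nat) :
  0 < q -> exists r, p * l = q * weight p q l + r /\ r < q.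
Proof.
  intros Hq. exists ((p * l) mod q). split; [apply Nat.div_mod; lia|apply Nat.mod_upper_bound; lia].
Qed.

Lemma weight_le (p q l : nat) : p < q -> weight p q l <= l.
Proof. intros H. unfold weight. apply Nat.Div0.div_le_upper_bound. nia. Qed.

Lemma weight_add_period (p q l k : nat) :
  0 < q -> weight p q (l + k * q) = weight p q l + k * p.
Proof.
  intros H. unfold weight. rewrite <- Nat.div_add by lia. f_equal. lia.
Qed.

Lemma weight_mono (p q l l' : nat) : l <= l' -> weight p q l <= weight p q l'.
Proof. intros H. unfold weight. apply Nat.Div0.div_le_mono. nia. Qed.

Lemma weight_S (p q l : nat) : p < q -> weight p q (S l) <= S (weight p q l).
Proof.
  intros H. destruct (weight_spec p q l) as (r & E & Hr); [lia|].
  destruct (weight_spec p q (S l)) as (r' & E' & Hr'); [lia|]. nia.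
Qed.

Lemma weight_unbounded (p q k : nat) : 0 < p -> 0 < q -> exists l, k <= weight p q l.
Proof.
  intros Hp Hq. exists (0 + k * q). rewrite weight_add_period by assumption. nia.
Qed.

Local Open Scope R_scope.

(** * Hausdorff measure of closed sets *)

Lemma sup_or0_ub (E : R -> Prop) (r : R) : bound E -> E r -> r <= sup_or0 E.
Proof.
  intros Hb Hr. unfold sup_or0.
  destruct (excluded_middle_informative (bound E)) as [B|]; [|tauto].
  destruct (excluded_middle_informative (exists r, E r)) as [N|N]; [|exfalso; eauto].
  destruct (completeness E B N) as [m [Hm Hm']]. now apply Hm.
Qed.

(** The bound must be nonnegative because of the default value 0 for empty or unbounded sets. *)
Lemma sup_or0_le (E : R -> Prop) (b : R) :
  0 <= b -> (forall r, E r -> r <= b) -> sup_or0 E <= b.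
Proof.
  intros H0 Hb. unfold sup_or0.
  destruct (excluded_middle_informative (bound E)) as [B|]; [|assumption].
  destruct (excluded_middle_informative (exists r, E r)) as [N|N]; [|assumption].
  destruct (completeness E B N) as [m [Hm' Hm]]. now apply Hm.
Qed.

Lemma half_pow_pos (n : nat) : 0 < (/ 2) ^ n.
Proof. apply pow_lt. lra. Qed.

Lemma half_pow_le (m n : nat) : (m <= n)%nat -> (/ 2) ^ n <= (/ 2) ^ m.
Proof.
  intros H. induction H as [|n H IH]; [lra|]. simpl. pose proof (half_pow_pos n). lra.
Qed.

Lemma half_pow_le_1 (n : nat) : (/ 2) ^ n <= 1.
Proof. apply (half_pow_le 0). lia. Qed.

Lemma half_pow_small (eps : R) : 0 < eps -> exists n, (/ 2) ^ n <= eps.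
Proof.
  intros H. destruct (pow_lt_1_zero (/ 2)) with (y := eps) as [n Hn]; [rewrite Rabs_right; lra|assumption|].
  exists n. specialize (Hn n (le_n n)). pose proof (Rle_abs ((/ 2) ^ n)). lra.
Qed.

Lemma dist_le (x y : nat -> bool) (n : nat) :
  (forall i, (i < n)%nat -> x i = y i) -> Defs.dist x y <= (/ 2) ^ n.
Proof.
  intros H. apply sup_or0_le; [pose proof (half_pow_pos n); lra|].
  intros r (i & Hi & ->). apply half_pow_le.
  destruct (Nat.le_gt_cases n i) as [|Hl]; [assumption|]. now apply H in Hl.
Qed.

Lemma dist_ge (x y : nat -> bool) (n : nat) : x n <> y n -> (/ 2) ^ n <= Defs.dist x y.
Proof.
  intros H. apply sup_or0_ub; [|eauto].
  exists 1. intros r (i & _ & ->). apply half_pow_le_1.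
Qed.

Lemma diam_ub (U : (nat -> bool) -> Prop) (x y : nat -> bool) :
  U x -> U y -> Defs.dist x y <= diam U.
Proof.
  intros Hx Hy. apply sup_or0_ub; [|eauto].
  exists 1. intros r (u & v & _ & _ & ->). apply (dist_le u v 0). lia.
Qed.

Definition cylinder (s : list bool) (x : nat -> bool) : Prop := initial x (length s) = s.

Lemma diam_cylinder (s : list bool) : diam (cylinder s) <= (/ 2) ^ length s.
Proof.
  apply sup_or0_le; [pose proof (half_pow_pos (length s)); lra|].
  intros r (x & y & Hx & Hy & ->). apply dist_le. apply initial_eq_iff. congruence.
Qed.

Lemma diam_empty : diam (fun _ => False) <= 0.
Proof. apply sup_or0_le; [lra|]. intros r (x & _ & [] & _). Qed.

(** Two points that differ at some i < m are at distance at least 2^(-i) > 2^(-m), so all points of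
    [U] share their first [m] bits. *)
Lemma subset_cylinder_of_diam (U : (nat -> bool) -> Prop) (m : nat) :
  diam U <= (/ 2) ^ m -> exists s, length s = m /\ forall x, U x -> cylinder s x.
Proof.
  intros H. destruct (excluded_middle_informative (exists x, U x)) as [[x Hx]|N].
  - exists (initial x m). split; [apply initial_length|]. intros y Hy.
    unfold cylinder. rewrite initial_length. apply initial_eq_iff. intros i Hi.
    apply NNPP. intros D. pose proof (dist_ge y x i D). pose proof (diam_ub U y x Hy Hx).
    pose proof (half_pow_le (S i) m Hi). pose proof (half_pow_pos i). simpl in *. lra.
  (* For empty [U] any string of length [m] will do. *)
  - exists (repeat true m). split; [apply repeat_length|]. intros y Hy. exfalso. eauto.
Qed.

Lemma Rdiv_lt_1 (a b : R) : 0 < b -> a < b -> a / b < 1.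
Proof.
  intros Hb Hab. apply Rmult_lt_reg_r with b; [assumption|].
  replace (a / b * b) with a by (field; lra). lra.
Qed.

Section Exponent.
Variables p q : nat.
Hypothesis hp : (0 < p)%nat.
Hypothesis hpq : (p < q)%nat.
Let s := INR p / INR q.

Lemma exponent_pos : 0 < s.
Proof. apply Rdiv_lt_0_compat; apply lt_0_INR; lia. Qed.

Lemma weight_bounds (l : nat) :
  INR (weight p q l) <= INR l * s < INR (weight p q l) + 1.
Proof.
  destruct (weight_spec p q l) as (r & E & Hr); [lia|].
  assert (Hq : 0 < INR q) by (apply lt_0_INR; lia).
  apply (f_equal INR) in E. rewrite plus_INR, !mult_INR in E.
  apply lt_INR in Hr. pose proof (pos_INR r).
  replace (INR l * s) with (INR (weight p q l) + INR r / INR q)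
    by (unfold s; field_simplify_eq; lra).
  assert (0 <= INR r / INR q) by (apply Rle_mult_inv_pos; lra).
  assert (INR r / INR q < 1) by (apply Rdiv_lt_1; assumption). lra.
Qed.

Lemma half_pow_Rpower (n : nat) : (/ 2) ^ n = Rpower 2 (- INR n).
Proof. rewrite pow_inv, Rpower_Ropp, Rpower_pow by lra. reflexivity. Qed.

Lemma powr_half_pow (l : nat) : powr ((/ 2) ^ l) s = Rpower 2 (- (INR l * s)).
Proof.
  unfold powr. pose proof (half_pow_pos l).
  destruct (Rle_dec ((/ 2) ^ l) 0); [lra|].
  rewrite half_pow_Rpower, Rpower_mult. f_equal. lra.
Qed.

Lemma powr_nonneg (t : R) : 0 <= powr t s.
Proof.
  unfold powr. destruct (Rle_dec t 0); [lra|]. left. apply exp_pos.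
Qed.

Lemma powr_mono (t t' : R) : t <= t' -> powr t s <= powr t' s.
Proof.
  intros H. unfold powr at 1. destruct (Rle_dec t 0); [apply powr_nonneg|].
  unfold powr. destruct (Rle_dec t' 0); [lra|].
  apply Rle_Rpower_l; [pose proof exponent_pos; lra|lra].
Qed.

Lemma powr_half_pow_le (l : nat) : powr ((/ 2) ^ l) s <= (/ 2) ^ weight p q l.
Proof.
  rewrite powr_half_pow, half_pow_Rpower. apply Rle_Rpower; [lra|].
  pose proof (weight_bounds l). lra.
Qed.

(** One factor 2 pays for rounding s m down, the other for passing from m to m+1, which costs 2^s <=
    2. *)
Lemma half_pow_weight_le (m : nat) :
  (/ 2) ^ weight p q m <= 4 * powr ((/ 2) ^ S m) s.
Proof.
  rewrite powr_half_pow, half_pow_Rpower.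
  replace 4 with (Rpower 2 (INR 2)) by (rewrite Rpower_pow; lra).
  rewrite <- Rpower_plus. apply Rle_Rpower; [lra|].
  pose proof (weight_bounds m). rewrite (S_INR m).
  assert (s <= 1).
  { unfold s. left. apply Rdiv_lt_1; [apply lt_0_INR; lia|now apply lt_INR]. }
  change (INR 2) with (1 + 1). lra.
Qed.

(** If 2^(-m-1) < diam U <= 2^(-m), a cylinder of length m costs at most a factor 4. The diameter
    may be 0 although cylinders have positive weight; very small sets are therefore put into a
    cylinder so deep that its weight is at most [eps]. *)
Lemma cylinder_hull (U : (nat -> bool) -> Prop) (n : nat) (eps : R) :
  0 < eps -> diam U <= (/ 2) ^ n ->
  exists t, (n <= length t)%nat /\ (forall x, U x -> cylinder t x) /\
    (/ 2) ^ weight p q (length t) <= 4 * powr (diam U) s + eps.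
Proof.
  intros He Hd.
  destruct (half_pow_small eps He) as [k Hk].
  destruct (weight_unbounded p q k) as [l Hl]; [lia|lia|].
  pose (N := max n l).
  assert (HN : (/ 2) ^ weight p q N <= eps).
  { eapply Rle_trans; [apply half_pow_le|apply Hk].
    eapply Nat.le_trans; [apply Hl|]. apply weight_mono. unfold N. lia. }
  (* Descending from scale [n], either the diameter is still below the current scale or its dyadic
     scale has been located. *)
  assert (H : forall j, diam U <= (/ 2) ^ (n + j) \/
    exists m, (n <= m)%nat /\ (/ 2) ^ S m < diam U <= (/ 2) ^ m).
  { induction j as [|j [IH|IH]].
    - left. now rewrite Nat.add_0_r.
    - destruct (Rle_lt_dec (diam U) ((/ 2) ^ S (n + j))).
      + left. now rewrite Nat.add_succ_r.
      + right. exists (n + j)%nat. split; [lia|]. lra.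
    - now right. }
  destruct (H (N - n)%nat) as [Hs|(m & Hm & Hlo & Hhi)].
  - replace (n + (N - n))%nat with N in Hs by (unfold N; lia).
    destruct (subset_cylinder_of_diam U N Hs) as (t & Ht & HU).
    exists t. rewrite Ht. split; [unfold N; lia|]. split; [assumption|].
    pose proof (powr_nonneg (diam U)). lra.
  - destruct (subset_cylinder_of_diam U m Hhi) as (t & Ht & HU).
    exists t. rewrite Ht. split; [lia|]. split; [assumption|].
    pose proof (half_pow_weight_le m). pose proof (powr_mono _ _ (Rlt_le _ _ Hlo)). lra.
Qed.

Definition rsum {A : Type} (f : A -> R) (l : list A) : R :=
  fold_right (fun a r => f a + r) 0 l.

Lemma rsum_app {A : Type} (f : A -> R) (l l' : list A) :
  rsum f (l ++ l') = rsum f l + rsum f l'.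
Proof. induction l as [|a l IH]; simpl; lra. Qed.

Lemma rsum_map {A B : Type} (f : B -> R) (g : A -> B) (l : list A) :
  rsum f (map g l) = rsum (fun a => f (g a)) l.
Proof. induction l as [|a l IH]; simpl; lra. Qed.

Lemma rsum_seq (f : nat -> R) (N : nat) : rsum f (seq 0 (S N)) = sum_f_R0 f N.
Proof.
  induction N as [|N IH]; [simpl; lra|].
  rewrite seq_S, rsum_app, IH. simpl. lra.
Qed.

Lemma rsum_nonneg {A : Type} (f : A -> R) (l : list A) :
  (forall a, 0 <= f a) -> 0 <= rsum f l.
Proof. intros H. induction l as [|a l IH]; simpl; [lra|]. specialize (H a). lra. Qed.

Lemma sum_nth_error_le {A : Type} (f : A -> R) (l : list A) (N : nat) :
  (forall a, 0 <= f a) ->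
  sum_f_R0 (fun i => match nth_error l i with Some a => f a | None => 0 end) N <= rsum f l.
Proof.
  intros Hf. revert N. induction l as [|a l IH]; intros N.
  - simpl. induction N as [|N IHN]; simpl; [lra|]. lra.
  - destruct N as [|N].
    + simpl. pose proof (rsum_nonneg f l Hf). lra.
    + rewrite decomp_sum by lia. simpl. specialize (IH N). lra.
Qed.

(** Multiplying by 2^L clears the denominators, so that covers can be compared in natural
    numbers. *)
Lemma INR_nsum_pow (f : list bool -> nat) (F : list (list bool)) (L : nat) :
  (forall t, In t F -> (f t <= L)%nat) ->
  INR (nsum (fun t => 2 ^ (L - f t)) F)%nat = 2 ^ L * rsum (fun t => (/ 2) ^ f t) F.
Proof.
  intros H. induction F as [|t F IH]; [simpl; lra|].
  rewrite nsum_cons. cbn [rsum fold_right]. fold (rsum (fun t => (/ 2) ^ f t) F).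
  rewrite plus_INR, IH by (intros; apply H; now right).
  assert (E : 2 ^ L = 2 ^ (L - f t) * 2 ^ f t).
  { rewrite <- pow_add. f_equal. specialize (H t (or_introl eq_refl)). lia. }
  rewrite Rmult_plus_distr_l. f_equal. rewrite E, pow_INR.
  rewrite Rmult_assoc, <- Rpow_mult_distr.
  replace (INR 2) with 2 by (simpl; lra).
  replace (2 * / 2) with 1 by lra. rewrite pow1. lra.
Qed.

Lemma sum_half_pow (N : nat) : sum_f_R0 (fun i => (/ 2) ^ i) N <= 2.
Proof.
  assert (H : sum_f_R0 (fun i => (/ 2) ^ i) N = 2 - (/ 2) ^ N).
  { induction N as [|N IH]; simpl in *; [lra|]. rewrite IH. lra. }
  pose proof (half_pow_pos N). lra.
Qed.

(* By compactness only finite covers by cylinders matter, and since [Hs_finite] is insensitive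
   to constant factors, the weight 2^(-s l) may be rounded to 2^(-weight p q l). *)
Lemma Hs_finite_iff (A : (nat -> bool) -> Prop) (T : list bool -> Prop) :
  downward_closed T -> (forall x, A x <-> forall n, T (initial x n)) ->
  Hs_finite s A <->
  exists M : nat, forall n, exists L F,
    (forall t, In t F -> n <= length t <= L)%nat /\
    (forall t, length t = L -> T t -> exists r, In r F /\ prefix r t) /\
    (nsum (fun t => 2 ^ (L - weight p q (length t))) F <= M * 2 ^ L)%nat.
Proof.
  intros Td HA. split.
  - intros [M HM].
    (* The cover is taken with error 1; [cylinder_hull] costs a factor 4 and the extra errors
       2^(-i), which sum to at most 2. *)
    destruct (INR_unbounded (4 * (M + 1) + 2)) as [M' HM'].
    exists M'. intros n.
    destruct (HM ((/ 2) ^ n) (half_pow_pos n) 1 Rlt_0_1) as (U & [Hcov Hdiam] & Hsum).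
    pose (t := fun i => proj1_sig (constructive_indefinite_description _
      (cylinder_hull (U i) n ((/ 2) ^ i) (half_pow_pos i) (Hdiam i)))).
    assert (Ht : forall i, (n <= length (t i))%nat /\ (forall x, U i x -> cylinder (t i) x) /\
      (/ 2) ^ weight p q (length (t i)) <= 4 * powr (diam (U i)) s + (/ 2) ^ i)
      by (intros i; apply proj2_sig).
    destruct (compactness T (fun r => exists i, t i = r) Td) as [L0 HL0].
    { intros x Hx. apply HA in Hx. destruct (Hcov x Hx) as [i Hi].
      exists (length (t i)), i. symmetry. now apply Ht. }
    (* Only finitely many strings of length [L0] have to be covered, so the cylinders with index up
       to some [N] suffice. *)
    destruct (list_uniform_bound (fun u i => length u = L0 -> T u -> prefix (t i) u)
      (all_strings L0)) as [N HN].
    { intros u _. destruct (excluded_middle_informative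
        (length u = L0 /\ T u)) as [[H1 H2]|H]; [|exists 0%nat; tauto].
      destruct (HL0 u H1 H2) as (r & [i <-] & Hr). now exists i. }
    destruct (list_uniform_bound (fun u i => length u <= i)%nat (map t (seq 0 (S N))))
      as [L1 HL1]; [intros u _; exists (length u); lia|].
    exists (max L0 L1), (map t (seq 0 (S N))). repeat split.
    + apply in_map_iff in H. destruct H as (i & <- & _). apply Ht.
    + destruct (HL1 _ H) as (i & Hi & Hl). lia.
    + intros u Hu HT.
      assert (Hl : length (firstn L0 u) = L0) by (rewrite firstn_length_le; lia).
      destruct (HN (firstn L0 u)) as (i & Hi & Hp); [rewrite <- Hl at 2; apply in_all_strings|].
      exists (t i). split; [apply in_map, in_seq; lia|].
      apply prefix_trans with (firstn L0 u); [|apply prefix_firstn_l].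
      apply Hp; [assumption|]. apply Td with u; [apply prefix_firstn_l|assumption].
    + apply INR_le. rewrite INR_nsum_pow.
      * rewrite mult_INR, pow_INR, Rmult_comm. replace (INR 2) with 2 by (simpl; lra).
        apply Rmult_le_compat_r; [apply pow_le; lra|].
        rewrite rsum_map, rsum_seq.
        apply Rle_trans with (sum_f_R0 (fun i => powr (diam (U i)) s * 4 + (/ 2) ^ i) N).
        -- apply sum_Rle. intros i _. pose proof (proj2 (proj2 (Ht i))). lra.
        -- rewrite sum_plus, <- scal_sum. specialize (Hsum N). pose proof (sum_half_pow N). change (sum_f_R0 (pow (/ 2)) N) with (sum_f_R0 (fun i => (/ 2) ^ i) N). lra.
      * intros u Hu. pose proof (weight_le p q (length u) hpq).
        destruct (HL1 _ Hu) as (i & Hi & Hl). lia.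
  - intros [M HM]. exists (INR M). intros delta Hdelta eps Heps.
    destruct (half_pow_small delta Hdelta) as [n Hn].
    destruct (HM n) as (L & F & Hlen & Hcov & Hsum).
    (* The finite cover is padded with empty sets, which contribute 0. *)
    exists (fun i => match nth_error F i with Some t => cylinder t | None => fun _ => False end).
    split; [split|].
    + intros x Hx. rewrite HA in Hx.
      destruct (Hcov (initial x L)) as (r & Hr & Hp); [apply initial_length|apply Hx|].
      apply In_nth_error in Hr. destruct Hr as [i Hi]. exists i. rewrite Hi.
      apply prefix_initial in Hp. unfold cylinder. now destruct Hp.
    + intros i. destruct (nth_error F i) as [t|] eqn:E.
      * apply nth_error_In, Hlen in E.
        pose proof (diam_cylinder t). pose proof (half_pow_le n (length t) ltac:(lia)). lra.
      * pose proof diam_empty. lra.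
    + intros N.
      apply Rle_trans with (rsum (fun t => (/ 2) ^ weight p q (length t)) F).
      * eapply Rle_trans; [apply sum_Rle|apply (sum_nth_error_le _ F N)].
        -- intros i _. cbv beta. destruct (nth_error F i) as [t|].
           ++ eapply Rle_trans; [apply powr_mono, diam_cylinder|apply powr_half_pow_le].
           ++ unfold powr. destruct (Rle_dec (diam (fun _ => False)) 0) as [_|H]; [lra|].
              exfalso. apply H, diam_empty.
        -- intros t. left. apply half_pow_pos.
      * apply le_INR in Hsum. rewrite INR_nsum_pow in Hsum.
        -- rewrite mult_INR, pow_INR in Hsum. replace (INR 2) with 2 in Hsum by (simpl; lra).
           pose proof (pow_lt 2 L ltac:(lra)).
           assert (rsum (fun t => (/ 2) ^ weight p q (length t)) F <= INR M); [|lra].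
           apply Rmult_le_reg_l with (2 ^ L); lra.
        -- intros t Ht. pose proof (Hlen t Ht). pose proof (weight_le p q (length t) hpq). lia.
Qed.
End Exponent.

Local Open Scope nat_scope.

(** * Membership in Sigma03 *)

(** The least significant bit comes first, so that taking a prefix of length i amounts to reducing m
    modulo 2^i. *)
Fixpoint bits (l m : nat) : list bool :=
  match l with
  | 0 => []
  | S l => Nat.odd m :: bits l (m / 2)
  end.

Fixpoint bits_value (s : list bool) : nat :=
  match s with
  | [] => 0
  | b :: s => Nat.b2n b + 2 * bits_value s
  end.

Lemma bits_length (l m : nat) : length (bits l m) = l.
Proof. revert m. induction l as [|l IH]; intros m; simpl; auto. Qed.

Lemma firstn_bits (i l m : nat) : i <= l -> firstn i (bits l m) = bits i m.
Proof.
  revert l m. induction i as [|i IH]; intros l m H; [reflexivity|].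
  destruct l as [|l]; [lia|]. simpl. now rewrite IH by lia.
Qed.

Lemma bits_value_spec (s : list bool) :
  bits (length s) (bits_value s) = s /\ bits_value s < 2 ^ length s.
Proof.
  induction s as [|b s [IH IHl]]; [simpl; auto|]. split.
  - cbn [length bits bits_value].
    replace (Nat.odd (Nat.b2n b + 2 * bits_value s)) with b.
    2:{ rewrite Nat.odd_add, Nat.odd_mul. now destruct b. }
    replace ((Nat.b2n b + 2 * bits_value s) / 2) with (bits_value s); [now rewrite IH|].
    rewrite (Nat.mul_comm 2), Nat.div_add by lia. now destruct b.
  - simpl length. rewrite Nat.pow_succ_r'. cbn [bits_value]. destruct b; simpl Nat.b2n; lia.
Qed.

(** [code_str] is bijective base 2: the strings of length l fill the block of 2^l codes from 2^l - 1
    on, ordered by value. *)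
Lemma code_str_bits (l m : nat) : code_str (bits l m) = 2 ^ l - 1 + m mod 2 ^ l.
Proof.
  enough (S (code_str (bits l m)) = 2 ^ l + m mod 2 ^ l)
    by (pose proof (Nat.pow_nonzero 2 l ltac:(lia)); lia).
  revert m. induction l as [|l IH]; intros m; [reflexivity|].
  cbn [bits code_str]. specialize (IH (m / 2)).
  rewrite Nat.pow_succ_r', Nat.Div0.mod_mul_r.
  rewrite <- Nat.bit0_mod, Nat.bit0_odd. destruct (Nat.odd m); simpl Nat.b2n; lia.
Qed.

Lemma code_str_inj (s t : list bool) : code_str s = code_str t -> s = t.
Proof.
  revert t. induction s as [|b s IH]; intros [|b' t]; cbn [code_str]; intros H;
    [reflexivity|destruct b'; lia|destruct b; lia|].
  assert (b = b' /\ code_str s = code_str t) as [-> E]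
    by (destruct b, b'; split; try reflexivity; lia).
  now rewrite (IH t E).
Qed.

Lemma bits_eq_iff (l m m' : nat) : bits l m = bits l m' <-> m mod 2 ^ l = m' mod 2 ^ l.
Proof.
  split; intros H.
  - apply (f_equal code_str) in H. rewrite !code_str_bits in H. lia.
  - apply code_str_inj. rewrite !code_str_bits. now rewrite H.
Qed.

Lemma prefix_bits (r : list bool) (l m : nat) :
  prefix r (bits l m) <-> r = bits (length r) m /\ length r <= l.
Proof.
  rewrite prefix_firstn, bits_length. split; intros [H Hl]; split; auto.
  - rewrite <- H at 1. now apply firstn_bits.
  - rewrite firstn_bits; auto.
Qed.

Definition gap (a b : nat) : nat := (a - b) + (b - a).

Lemma gap_eq_0 (a b : nat) : gap a b = 0 <-> a = b.
Proof. unfold gap. lia. Qed.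

(** Every number is read as a stream of nested pairs; the length of a coded list is supplied
    separately. *)
Definition item (G i : nat) : nat := p1 (Nat.iter i p2 G).

Lemma item_surjective (l : list nat) :
  exists G, forall i, i < length l -> item G i = nth i l 0.
Proof.
  induction l as [|a l [G IH]]; [exists 0; simpl; lia|].
  exists (cpair a G). intros [|i] Hi; unfold item.
  - simpl. now autorewrite with pairs.
  - simpl. rewrite <- Nat.iter_swap. autorewrite with pairs. apply IH. simpl in Hi. lia.
Qed.

Lemma computable_item (G i : nat -> nat) :
  computable G -> computable i -> computable (fun x => item (G x) (i x)).
Proof.
  intros HG Hi. apply computable_p1, (computable_iter i G p2); comp.
Qed.

Lemma nsum_map_seq (f : list bool -> nat) (g : nat -> list bool) (N : nat) :
  nsum f (map g (seq 0 N)) = bsum N (fun i => f (g i)).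
Proof.
  induction N as [|N IH]; [reflexivity|].
  rewrite seq_S, map_app, bsum_S, <- IH. unfold nsum.
  rewrite map_app, list_sum_app. simpl. lia.
Qed.

Lemma list_as_map_seq {A : Type} (l : list A) (d : A) :
  map (fun i => nth i l d) (seq 0 (length l)) = l.
Proof.
  apply (nth_ext _ _ d d); rewrite length_map, length_seq; [reflexivity|].
  intros n Hn. rewrite (nth_indep _ d (nth 0 l d)) by now rewrite length_map, length_seq.
  rewrite (map_nth (fun i => nth i l d)), seq_nth by assumption. reflexivity.
Qed.

Definition converges (e : nat) (r : list bool) : Prop := exists t, conv_in e t (code_str r).

(** Drops the time bound from [inT]. The infinite paths stay the same, since longer initial segments
    grant more steps. *)
Definition alive (e : nat) (u : list bool) : Prop := forall r, prefix r u -> ~ converges e r.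

Lemma alive_downward_closed (e : nat) : downward_closed (alive e).
Proof. intros r u Hru Hu r' Hr'. apply Hu. now apply prefix_trans with r. Qed.

Lemma paths_iff_alive (e : nat) (x : nat -> bool) :
  paths e x <-> forall n, alive e (initial x n).
Proof.
  split.
  - intros H n r Hr [t [y Ht]].
    destruct (prefix_initial _ _ _ Hr) as [E Hl].
    apply (H (max n t) r).
    + rewrite E. apply initial_prefix. lia.
    + rewrite initial_length. exists y. apply eval_mono with t; [lia|assumption].
  - intros H n r Hr Hc. apply (H n r Hr). eexists; eassumption.
Qed.

(** There are finitely many strings of length [L], and halting persists, so the largest of their
    halting times serves for all. *)
Lemma halted_uniform_bound (e L : nat) (P : list bool -> Prop) :
  (forall u, length u = L -> P u \/ exists r, prefix r u /\ converges e r) ->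
  exists k, forall u, length u = L -> P u \/ exists r, prefix r u /\ halted (run k e (code_str r)).
Proof.
  intros H.
  destruct (list_uniform_bound (fun u k => length u = L ->
    P u \/ exists r, prefix r u /\ halted (run k e (code_str r))) (all_strings L)) as [k Hk].
  { intros u _. destruct (Nat.eq_dec (length u) L) as [E|E]; [|exists 0; tauto].
    destruct (H u E) as [HP|(r & Hr & Hc)]; [exists 0; tauto|].
    apply halted_run_iff in Hc. destruct Hc as [k Hc]. exists k. eauto. }
  exists k. intros u Hu. subst L. destruct (Hk u (in_all_strings u)) as (j & Hj & Hd).
  destruct (Hd eq_refl) as [HP|(r & Hr & Hh)]; [now left|].
  right. exists r. split; [assumption|]. now apply halted_iter_mono with j.
Qed.

Section Membership.
Variables p q : nat.
Hypothesis hp : 0 < p.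
Hypothesis hpq : p < q.

(* [G] codes [N] pairs (length, value) of bit strings. The three summands vanish when these strings
   have lengths in [n, L], when their total weight is at most [M], and when every string of
   length [L] extends one of them or is seen, after [k] machine steps, to have left the tree. *)
Definition cover_defect (e M n L k N G : nat) : nat :=
  bsum N (fun i => (n - p1 (item G i)) + (p1 (item G i) - L))
  + (bsum N (fun i => 2 ^ (L - p * p1 (item G i) / q)) - M * 2 ^ L)
  + bsum (2 ^ L) (fun m =>
      bprod N (fun i => gap (m mod 2 ^ p1 (item G i)) (p2 (item G i)))
      * bprod (S L) (fun i => running k e (2 ^ i - 1 + m mod 2 ^ i))).

Lemma cover_defect_eq_0 (e M n L k N G : nat) :
  cover_defect e M n L k N G = 0 <->
  (forall i, i < N -> n <= p1 (item G i) <= L) /\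
  bsum N (fun i => 2 ^ (L - weight p q (p1 (item G i)))) <= M * 2 ^ L /\
  (forall m, m < 2 ^ L ->
     (exists i, i < N /\ m mod 2 ^ p1 (item G i) = p2 (item G i)) \/
     (exists i, i < S L /\ halted (run k e (code_str (bits i m))))).
Proof.
  unfold cover_defect. rewrite !Nat.eq_add_0, Nat.sub_0_le, !bsum_eq_0. unfold weight.
  assert (E : forall m, bprod N (fun i => gap (m mod 2 ^ p1 (item G i)) (p2 (item G i)))
      * bprod (S L) (fun i => running k e (2 ^ i - 1 + m mod 2 ^ i)) = 0 <->
     (exists i, i < N /\ m mod 2 ^ p1 (item G i) = p2 (item G i)) \/
     (exists i, i < S L /\ halted (run k e (code_str (bits i m))))).
  { intros m. rewrite Nat.eq_mul_0, !bprod_eq_0.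
    setoid_rewrite gap_eq_0. setoid_rewrite running_eq_0. setoid_rewrite code_str_bits.
    reflexivity. }
  setoid_rewrite E. rewrite <- and_assoc.
  assert (H : (forall i, i < N -> n - p1 (item G i) + (p1 (item G i) - L) = 0) <->
    (forall i, i < N -> n <= p1 (item G i) <= L)).
  { split; intros H i Hi; specialize (H i Hi); lia. }
  rewrite H. reflexivity.
Qed.

Lemma computable_cover_defect (e M n L k N G : nat -> nat) :
  computable e -> computable M -> computable n -> computable L -> computable k ->
  computable N -> computable G ->
  computable (fun x => cover_defect (e x) (M x) (n x) (L x) (k x) (N x) (G x)).
Proof.
  intros. unfold cover_defect, gap.
  repeat first [ progress comp | apply computable_item | apply computable_running ].
Qed.

(** The cover condition concerns strings that are alive, a co-r.e. property. Asking instead that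
    each uncovered string is seen to die within [k] steps makes it decidable in the witnesses. *)
Lemma Hs_finite_iff_cover_defect (e : nat) :
  Hs_finite (INR p / INR q) (paths e) <->
  exists M, forall n, exists L k N G, cover_defect e M n L k N G = 0.
Proof.
  rewrite (Hs_finite_iff p q hp hpq _ (alive e) (alive_downward_closed e) (paths_iff_alive e)).
  split; intros [M HM]; exists M; intros n; specialize (HM n).
  - destruct HM as (L & F & Hlen & Hcov & Hsum).
    destruct (halted_uniform_bound e L (fun u => exists r, In r F /\ prefix r u)) as [k Hk].
    { intros u Hu. apply NNPP. intros Hn. apply Hn. left. apply Hcov; [assumption|].
      intros r Hr Hc. apply Hn. right. eauto. }
    destruct (item_surjective (map (fun t => cpair (length t) (bits_value t)) F)) as [G HG].
    rewrite length_map in HG.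
    assert (HG' : forall i, i < length F ->
      p1 (item G i) = length (nth i F []) /\ p2 (item G i) = bits_value (nth i F [])).
    { intros i Hi. rewrite HG by assumption.
      (* The default is replaced by the image of the empty string, as [map_nth] requires. *)
      rewrite (nth_indep _ 0 (cpair (length (@nil bool)) (bits_value [])))
        by now rewrite length_map.
      rewrite (map_nth (fun t => cpair (length t) (bits_value t))).
      now autorewrite with pairs. }
    exists L, k, (length F), G. apply cover_defect_eq_0. split; [|split].
    + intros i Hi. rewrite (proj1 (HG' i Hi)). apply Hlen. now apply nth_In.
    + rewrite (bsum_ext _ _ (fun i => 2 ^ (L - weight p q (length (nth i F []))))).
      * rewrite <- (nsum_map_seq (fun t => 2 ^ (L - weight p q (length t))) (fun i => nth i F [])).
        now rewrite list_as_map_seq.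
      * intros i Hi. now rewrite (proj1 (HG' i Hi)).
    + intros m Hm.
      destruct (Hk (bits L m) (bits_length L m)) as [(r & Hr & Hp)|(r & Hp & Hh)].
      * left. apply (In_nth _ _ []) in Hr. destruct Hr as (i & Hi & <-).
        exists i. split; [assumption|]. destruct (HG' i Hi) as [-> ->].
        apply prefix_bits in Hp. destruct Hp as [Hp _].
        destruct (bits_value_spec (nth i F [])) as [Hb Hlt].
        rewrite <- Hb in Hp at 1. apply bits_eq_iff in Hp.
        rewrite <- Hp. now apply Nat.mod_small.
      * right. apply prefix_bits in Hp. destruct Hp as [Hp Hl].
        exists (length r). split; [lia|]. now rewrite <- Hp.
  - destruct HM as (L & k & N & G & H). apply cover_defect_eq_0 in H.
    destruct H as (Hlen & Hsum & Hcov).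
    exists L, (map (fun i => bits (p1 (item G i)) (p2 (item G i))) (seq 0 N)).
    split; [|split].
    + intros t Ht. apply in_map_iff in Ht. destruct Ht as (i & <- & Hi).
      rewrite bits_length. apply Hlen. apply in_seq in Hi. lia.
    + intros u Hu Ha. destruct (bits_value_spec u) as [Hb Hlt]. rewrite Hu in Hb, Hlt.
      destruct (Hcov _ Hlt) as [(i & Hi & Hm)|(i & Hi & Hh)].
      * exists (bits (p1 (item G i)) (p2 (item G i))). split.
        -- apply (in_map (fun i => bits (p1 (item G i)) (p2 (item G i)))), in_seq. lia.
        -- rewrite <- Hb. apply prefix_bits. rewrite bits_length.
           split; [|now apply Hlen]. apply bits_eq_iff.
           rewrite <- Hm. now rewrite Nat.Div0.mod_mod.
      * exfalso. apply (Ha (bits i (bits_value u))).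
        -- rewrite <- Hb at 2. apply prefix_bits. rewrite bits_length. split; [reflexivity|lia].
        -- apply halted_run_iff. now exists k.
    + rewrite (nsum_map_seq (fun t => 2 ^ (L - weight p q (length t)))).
      erewrite bsum_ext; [exact Hsum|]. intros i _. cbv beta. now rewrite bits_length.
Qed.

Lemma Sigma03_Hs_finite : Sigma03 (fun e => Hs_finite (INR p / INR q) (paths e)).
Proof.
  exists (fun z => cover_defect (p1 z) (p1 (p2 z)) (p1 (p2 (p2 z)))
    (p1 (p2 (p2 (p2 z)))) (p1 (p2 (p2 (p2 (p2 z)))))
    (p1 (p2 (p2 (p2 (p2 (p2 z)))))) (p2 (p2 (p2 (p2 (p2 (p2 z))))))).
  split; [apply computable_cover_defect; comp|].
  intros e. rewrite Hs_finite_iff_cover_defect.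
  split; intros [M HM]; exists M; intros n; specialize (HM n).
  - destruct HM as (L & k & N & G & H). exists (cpair L (cpair k (cpair N G))).
    now autorewrite with pairs.
  - destruct HM as [c H]. autorewrite with pairs in H. do 4 eexists. exact H.
Qed.

End Membership.

(** * Homogeneous trees *)

Lemma nsum_app {A : Type} (f : A -> nat) (l l' : list A) :
  nsum f (l ++ l') = nsum f l + nsum f l'.
Proof. unfold nsum. now rewrite map_app, list_sum_app. Qed.

Lemma nsum_in_le {A : Type} (f : A -> nat) (a : A) (l : list A) : In a l -> f a <= nsum f l.
Proof.
  induction l as [|b l IH]; intros H; [easy|]. rewrite nsum_cons.
  destruct H as [->|H]; [lia|]. specialize (IH H). lia.
Qed.

Lemma nsum_le {A : Type} (f g : A -> nat) (l : list A) :
  (forall a, In a l -> f a <= g a) -> nsum f l <= nsum g l.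
Proof.
  induction l as [|a l IH]; intros H; [reflexivity|]. rewrite !nsum_cons.
  pose proof (H a (or_introl eq_refl)). specialize (IH (fun b Hb => H b (or_intror Hb))). lia.
Qed.

Lemma nsum_mul_r {A : Type} (f : A -> nat) (k : nat) (l : list A) :
  nsum (fun a => f a * k) l = nsum f l * k.
Proof. induction l as [|a l IH]; [reflexivity|]. rewrite !nsum_cons, IH. lia. Qed.

Lemma nth_initial (x : nat -> bool) (n i : nat) : i < n -> nth i (initial x n) false = x i.
Proof.
  intros H. unfold initial. rewrite (nth_indep _ false (x 0)) by now rewrite length_map, length_seq.
  rewrite map_nth, seq_nth by assumption. reflexivity.
Qed.

Section Homogeneous.
Variable br : nat -> nat.
Variable cnt : nat -> nat.
Hypothesis cnt_0 : cnt 0 = 0.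
Hypothesis cnt_S : forall l, cnt (S l) = cnt l + br l.
Hypothesis br_le_1 : forall l, br l <= 1.

(** [u] is a piece of a path that starts at level [j]; the default [false] of [nth] puts no
    condition beyond its end. *)
Definition compat (j : nat) (u : list bool) : Prop :=
  forall i, nth i u false = true -> br (j + i) <> 0.

Lemma compat_cons (j : nat) (b : bool) (u : list bool) :
  compat j (b :: u) <-> (b = true -> br j <> 0) /\ compat (S j) u.
Proof.
  unfold compat. split.
  - intros H. split.
    + intros Hb. specialize (H 0 Hb). now rewrite Nat.add_0_r in H.
    + intros i Hi. specialize (H (S i) Hi). now rewrite Nat.add_succ_r in H.
  - intros [H1 H2] [|i] Hi; simpl in Hi.
    + rewrite Nat.add_0_r. auto.
    + rewrite Nat.add_succ_r. now apply H2.
Qed.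

Lemma compat_downward_closed (j : nat) : downward_closed (compat j).
Proof.
  intros r s [v ->] H i Hi. apply H.
  destruct (Nat.lt_ge_cases i (length r)); [now rewrite app_nth1|].
  rewrite nth_overflow in Hi; [discriminate|assumption].
Qed.

Lemma compat_initial_iff (x : nat -> bool) :
  (forall j, x j = true -> br j <> 0) <-> forall n, compat 0 (initial x n).
Proof.
  split.
  - intros H n i Hi. destruct (Nat.lt_ge_cases i n) as [Hl|Hl].
    + rewrite nth_initial in Hi by assumption. now apply H.
    + rewrite nth_overflow in Hi; [discriminate|]. now rewrite initial_length.
  - intros H j Hj. apply (H (S j) j). now rewrite nth_initial by lia.
Qed.

Fixpoint level (l j : nat) : list (list bool) :=
  match l with
  | 0 => [[]]
  | S l => map (cons false) (level l (S j)) ++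
           match br j with 0 => [] | S _ => map (cons true) (level l (S j)) end
  end.

Lemma in_level (l j : nat) (u : list bool) :
  In u (level l j) <-> length u = l /\ compat j u.
Proof.
  revert j u. induction l as [|l IH]; intros j u; simpl.
  - split.
    + intros [<-|[]]. split; [reflexivity|]. intros [|i]; discriminate.
    + intros [H _]. destruct u; [auto|discriminate].
  - rewrite in_app_iff. split.
    + intros [H|H].
      * apply in_map_iff in H. destruct H as (v & <- & H). apply IH in H.
        rewrite compat_cons. simpl. intuition congruence.
      * destruct (br j) eqn:E; [easy|].
        apply in_map_iff in H. destruct H as (v & <- & H). apply IH in H.
        rewrite compat_cons. simpl. intuition congruence.
    + intros [H1 H2]. destruct u as [|b u]; [discriminate|]. injection H1 as H1.
      apply compat_cons in H2. destruct H2 as [H2 H3].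
      destruct b.
      * right. destruct (br j); [now destruct H2|]. apply in_map, IH. auto.
      * left. apply in_map, IH. auto.
Qed.

Lemma length_level_S (l j : nat) :
  length (level (S l) j) = length (level l (S j)) * 2 ^ br j.
Proof.
  simpl. rewrite length_app, length_map. pose proof (br_le_1 j).
  destruct (br j) as [|[|]]; simpl; [lia|rewrite length_map; lia|lia].
Qed.

(** Each branching level doubles the number of nodes; the product form avoids subtraction in the
    exponent. *)
Lemma length_level (l j : nat) : length (level l j) * 2 ^ cnt j = 2 ^ cnt (j + l).
Proof.
  revert j. induction l as [|l IH]; intros j.
  - rewrite Nat.add_0_r. simpl. lia.
  - rewrite length_level_S, Nat.add_succ_r, <- Nat.add_succ_l, <- IH, cnt_S, Nat.pow_add_r. lia.
Qed.

(** This is the cover that [F] induces on the subtree above the child [b]. *)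
Definition tails (b : bool) (F : list (list bool)) : list (list bool) :=
  flat_map (fun r => match r with
                     | [] => []
                     | b' :: r => if Bool.eqb b b' then [r] else []
                     end) F.

Lemma in_tails (b : bool) (F : list (list bool)) (r : list bool) :
  In r (tails b F) <-> In (b :: r) F.
Proof.
  unfold tails. rewrite in_flat_map. split.
  - intros ([|b' r'] & H & Hr); [easy|]. destruct (Bool.eqb_spec b b') as [<-|]; [|easy].
    destruct Hr as [->|[]]. assumption.
  - intros H. exists (b :: r). split; [assumption|]. rewrite Bool.eqb_reflx. now left.
Qed.

(** Each nonempty string of [F] enters exactly one of the two lists; empty strings are dropped,
    hence only an inequality. *)
Lemma nsum_tails_le (f : list bool -> nat) (F : list (list bool)) :
  nsum (fun r => f (false :: r)) (tails false F) + nsum (fun r => f (true :: r)) (tails true F)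
  <= nsum f F.
Proof.
  induction F as [|[|b r] F IH]; [reflexivity|rewrite nsum_cons; simpl tails; lia|].
  change (tails true ((b :: r) :: F))
    with ((if Bool.eqb true b then [r] else []) ++ tails true F).
  change (tails false ((b :: r) :: F))
    with ((if Bool.eqb false b then [r] else []) ++ tails false F).
  rewrite nsum_cons, !nsum_app. destruct b; simpl Bool.eqb; cbv iota; rewrite nsum_cons.
  - change (nsum (fun r => f (true :: r)) []) with 0.
    change (nsum (fun r => f (false :: r)) []) with 0. lia.
  - change (nsum (fun r => f (true :: r)) []) with 0.
    change (nsum (fun r => f (false :: r)) []) with 0. lia.
Qed.

(* Kraft's inequality for the tree, in multiplied-out form. *)
Lemma cover_count (l j : nat) (F : list (list bool)) :
  (forall r, In r F -> length r <= l) ->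
  (forall u, length u = l -> compat j u -> exists r, In r F /\ prefix r u) ->
  length (level l j) <= nsum (fun r => length (level (l - length r) (j + length r))) F.
Proof.
  assert (Hroot : forall l j F, In [] F ->
    length (level l j) <= nsum (fun r : list bool => length (level (l - length r) (j + length r))) F).
  { intros l' j' F' H'.
    apply (nsum_in_le (fun r : list bool => length (level (l' - length r) (j' + length r)))) in H'.
    simpl in H'. now rewrite Nat.sub_0_r, Nat.add_0_r in H'. }
  revert j F. induction l as [|l IH]; intros j F Hlen Hcov;
    (destruct (in_dec (list_eq_dec Bool.bool_dec) [] F) as [Hnil|Hnil]; [now apply Hroot|]).
  - exfalso. destruct (Hcov []) as (r & Hr & [v Hv]); [reflexivity|intros [|i]; discriminate|].
    destruct r; [auto|discriminate].
  - set (f := fun r => length (level (S l - length r) (j + length r))).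
    pose proof (nsum_tails_le f F) as Ht.
    (* For each child present in the tree, the induced cover satisfies the induction hypothesis one
       level up. *)
    assert (Hb : forall b, (b = true -> br j <> 0) ->
      length (level l (S j)) <= nsum (fun r => f (b :: r)) (tails b F)).
    { intros b Hb. eapply Nat.le_trans; [apply (IH (S j) (tails b F))|].
      - intros r Hr. apply in_tails, Hlen in Hr. simpl in Hr. lia.
      - intros u Hu Hc. destruct (Hcov (b :: u)) as (r & Hr & [v Hv]).
        + simpl. lia.
        + apply compat_cons. auto.
        + destruct r as [|b' r]; [easy|]. injection Hv as -> ->.
          exists r. split; [now apply in_tails|now exists v].
      - apply nsum_le. intros r _. unfold f. simpl length. rewrite Nat.add_succ_r. reflexivity. }
    rewrite length_level_S. pose proof (br_le_1 j) as H1.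
    pose proof (Hb false ltac:(discriminate)) as Hf.
    destruct (br j) as [|[|]] eqn:E; [simpl; lia| |lia].
    specialize (Hb true ltac:(lia)). simpl. lia.
Qed.

Variables p q : nat.
Hypothesis hp : 0 < p.
Hypothesis hpq : p < q.
Variable A : (nat -> bool) -> Prop.
Hypothesis HA : forall x, A x <-> forall j, x j = true -> br j <> 0.

Lemma A_iff_compat (x : nat -> bool) : A x <-> forall n, compat 0 (initial x n).
Proof. rewrite HA. apply compat_initial_iff. Qed.

Lemma cnt_le (l : nat) : cnt l <= l.
Proof.
  induction l as [|l IH]; [now rewrite cnt_0|]. rewrite cnt_S. specialize (br_le_1 l). lia.
Qed.

Lemma cnt_mono (l l' : nat) : l <= l' -> cnt l <= cnt l'.
Proof. intros H. induction H as [|l' H IH]; [lia|]. rewrite cnt_S. lia. Qed.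

(** The cover consists of all 2^(cnt l) strings of a level l with few branchings below it; its total
    weight is 2^(cnt l - weight l) <= 2^M. *)
Lemma Hs_finite_of_few_branchings (M : nat) :
  (forall n, exists l, n <= l /\ cnt l <= weight p q l + M) ->
  Hs_finite (INR p / INR q) A.
Proof.
  intros H. apply (Hs_finite_iff p q hp hpq A _ (compat_downward_closed 0) A_iff_compat).
  exists (2 ^ M). intros n. destruct (H n) as (l & Hl & Hc).
  exists l, (level l 0). split; [|split].
  - intros t Ht. apply in_level in Ht. lia.
  - intros t Ht HT. exists t. split; [now apply in_level|]. exists []. now rewrite app_nil_r.
  - rewrite <- Nat.pow_add_r.
    apply Nat.le_trans with (nsum (fun t : list bool => 1 * 2 ^ (l - weight p q l)) (level l 0)).
    + apply nsum_le. intros t Ht. apply in_level in Ht. destruct Ht as [-> _]. lia.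
    + rewrite (nsum_mul_r (fun _ => 1)).
      replace (nsum (fun _ => 1) (level l 0)) with (length (level l 0)).
      2:{ induction (level l 0) as [|t F IH]; [reflexivity|]. rewrite nsum_cons, <- IH. reflexivity. }
      pose proof (length_level l 0) as E. rewrite cnt_0, Nat.mul_1_r in E. simpl in E.
      rewrite E, <- Nat.pow_add_r. apply Nat.pow_le_mono_r; [lia|].
      pose proof (weight_le p q l hpq). lia.
Qed.

(** Deep strings r satisfy 2^(-weight r) >= 2^M 2^(-cnt r), and by [cover_count] the numbers 2^(-cnt
    r) of a cover sum to at least 1. So the total weight is at least 2^M > M. *)
Lemma Hs_infinite_of_many_branchings :
  (forall M, exists l0, forall l, l0 <= l -> weight p q l + M <= cnt l) ->
  ~ Hs_finite (INR p / INR q) A.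
Proof.
  intros H Hfin.
  apply (Hs_finite_iff p q hp hpq A _ (compat_downward_closed 0) A_iff_compat) in Hfin.
  destruct Hfin as [M HM]. destruct (H M) as [n Hn].
  destruct (HM n) as (L & F & Hlen & Hcov & Hsum).
  pose proof (cover_count L 0 F (fun r Hr => proj2 (Hlen r Hr)) Hcov) as Hc.
  pose proof (length_level L 0) as E. rewrite cnt_0, Nat.mul_1_r in E. simpl in E.
  pose proof (cnt_le L) as HL.
  (* A cover string r has 2^(cnt L - cnt r) extensions at level [L]; the chosen factor turns this
     into 2^(L - cnt r + M), which is at most 2^(L - weight r). *)
  assert (Hle : nsum (fun r => length (level (L - length r) (0 + length r))) F
      * 2 ^ (L - cnt L + M) <= nsum (fun t => 2 ^ (L - weight p q (length t))) F).
  { rewrite <- nsum_mul_r. apply nsum_le. intros r Hr. destruct (Hlen r Hr) as [Hr1 Hr2].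
    pose proof (length_level (L - length r) (length r)) as Er.
    replace (length r + (L - length r)) with L in Er by lia.
    pose proof (cnt_mono _ _ Hr2). specialize (Hn _ Hr1).
    replace (cnt L) with (cnt L - cnt (length r) + cnt (length r)) in Er by lia.
    rewrite Nat.pow_add_r in Er. apply Nat.mul_cancel_r in Er; [|now apply Nat.pow_nonzero].
    simpl Nat.add. rewrite Er, <- Nat.pow_add_r. apply Nat.pow_le_mono_r; lia. }
  rewrite E in Hc.
  assert (Hpow : 2 ^ cnt L * 2 ^ (L - cnt L + M) = 2 ^ M * 2 ^ L).
  { rewrite <- !Nat.pow_add_r. f_equal. lia. }
  pose proof (Nat.pow_gt_lin_r 2 M ltac:(lia)).
  assert (2 ^ M * 2 ^ L <= M * 2 ^ L).
  { rewrite <- Hpow. eapply Nat.le_trans; [apply Nat.mul_le_mono_r, Hc|]. lia. }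
  assert (2 ^ L <> 0) by now apply Nat.pow_nonzero. nia.
Qed.

End Homogeneous.

(** * Hardness *)

Section Schedule.
Variables p q : nat.

(* The state at level [l] is a pair (number of branchings below [l], current stage). *)
Definition state (h : nat -> nat) (l : nat) : nat :=
  nat_rect (fun _ => nat) (cpair 0 0)
    (fun l z => ifz (p1 z - (p * l / q + h (p2 z))) (cpair (S (p1 z)) (S (p2 z))) z) l.

Definition count (h : nat -> nat) (l : nat) : nat := p1 (state h l).
Definition stage (h : nat -> nat) (l : nat) : nat := p2 (state h l).
Definition branch (h : nat -> nat) (l : nat) : nat :=
  1 - (count h l - (p * l / q + h (stage h l))).

Variable h : nat -> nat.

Lemma state_S_branch (l : nat) :
  count h l <= weight p q l + h (stage h l) ->
  count h (S l) = S (count h l) /\ stage h (S l) = S (stage h l).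
Proof.
  intros H. unfold count, stage, weight in *. cbn [state nat_rect].
  fold (state h l). replace (p1 (state h l) - (p * l / q + h (p2 (state h l)))) with 0 by lia.
  cbn [ifz]. now autorewrite with pairs.
Qed.

Lemma state_S_wait (l : nat) :
  weight p q l + h (stage h l) < count h l ->
  count h (S l) = count h l /\ stage h (S l) = stage h l.
Proof.
  intros H. unfold count, stage, weight in *. cbn [state nat_rect].
  fold (state h l).
  destruct (p1 (state h l) - (p * l / q + h (p2 (state h l)))) eqn:E; [lia|].
  cbn [ifz]. auto.
Qed.

Lemma count_S (l : nat) : count h (S l) = count h l + branch h l.
Proof.
  unfold branch. fold (weight p q l).
  destruct (Nat.le_gt_cases (count h l) (weight p q l + h (stage h l))) as [H|H].
  - rewrite (proj1 (state_S_branch l H)). lia.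
  - rewrite (proj1 (state_S_wait l H)). lia.
Qed.

Lemma count_0 : count h 0 = 0.
Proof. unfold count. simpl. now autorewrite with pairs. Qed.

Lemma branch_le_1 (l : nat) : branch h l <= 1.
Proof. unfold branch. lia. Qed.

Lemma stage_S_le (l : nat) : stage h l <= stage h (S l) <= S (stage h l).
Proof.
  destruct (Nat.le_gt_cases (count h l) (weight p q l + h (stage h l))) as [H|H].
  - rewrite (proj2 (state_S_branch l H)). lia.
  - rewrite (proj2 (state_S_wait l H)). lia.
Qed.

Lemma stage_mono (l l' : nat) : l <= l' -> stage h l <= stage h l'.
Proof. intros H. induction H as [|l' H IH]; [lia|]. pose proof (stage_S_le l'). lia. Qed.

Lemma stage_le (l : nat) : stage h l <= l.
Proof.
  induction l as [|l IH]; [unfold stage; simpl; now autorewrite with pairs|].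
  pose proof (stage_S_le l). lia.
Qed.

Hypothesis hp : 0 < p.
Hypothesis hpq : p < q.

(** While the schedule waits, the count stays fixed and the weight is unbounded, so the threshold of
    the stage is met eventually. *)
Lemma stage_stays_or_reached (t l : nat) :
  stage h l = t -> exists l, stage h l = t /\ count h l <= weight p q l + h t.
Proof.
  intros Hl. apply NNPP. intros N.
  assert (Hw : forall d, stage h (l + d) = t /\ count h (l + d) = count h l).
  { induction d as [|d [IH1 IH2]]; [now rewrite Nat.add_0_r|].
    rewrite Nat.add_succ_r. destruct (state_S_wait (l + d)) as [E1 E2].
    - rewrite IH1. apply Nat.nle_gt. intros Hle. apply N. eauto.
    - rewrite E1, E2. auto. }
  destruct (weight_unbounded p q (count h l)) as [m Hm]; [lia|lia|].
  apply N. exists (l + m). destruct (Hw m) as [E1 E2]. split; [assumption|].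
  rewrite E2. pose proof (weight_mono p q m (l + m) ltac:(lia)). lia.
Qed.

Lemma stage_reached (t : nat) :
  exists l, stage h l = t /\ count h l <= weight p q l + h t.
Proof.
  induction t as [|t (l & Hl & Hc)].
  - apply (stage_stays_or_reached 0 0). pose proof (stage_le 0). lia.
  - apply (stage_stays_or_reached (S t) (S l)). subst t. now apply state_S_branch.
Qed.

Lemma few_branchings_of_liminf (M : nat) :
  (forall T, exists t, T <= t /\ h t <= M) ->
  forall n, exists l, n <= l /\ count h l <= weight p q l + M.
Proof.
  intros H n. destruct (H n) as (t & Ht & HM). destruct (stage_reached t) as (l & Hl & Hc).
  exists l. pose proof (stage_le l). lia.
Qed.

(** From stage [T] on, branching is forced whenever the count is at most weight + [M]. The count
    first catches up, because p < q, and then never falls behind: the weight grows by at most 1 per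
    level, and at equality a branching occurs. *)
Lemma many_branchings_of_lim :
  (forall M, exists T, forall t, T <= t -> M <= h t) ->
  forall M, exists l0, forall l, l0 <= l -> weight p q l + M <= count h l.
Proof.
  intros H M. destruct (H M) as [T HT]. destruct (stage_reached T) as (l1 & Hl1 & _).
  assert (Hup : forall l, l1 <= l -> count h l <= weight p q l + M ->
    count h (S l) = S (count h l)).
  { intros l Hl Hc. apply state_S_branch.
    specialize (HT (stage h l)). rewrite <- Hl1 in HT. specialize (HT (stage_mono _ _ Hl)). lia. }
  assert (Hreach : exists l, l1 <= l /\ weight p q l + M <= count h l).
  { apply NNPP. intros N.
    assert (Hd : forall d, count h (l1 + d) = count h l1 + d).
    { induction d as [|d IH]; [now rewrite !Nat.add_0_r|].
      rewrite Nat.add_succ_r, Hup; [lia|lia|].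
      destruct (Nat.le_gt_cases (weight p q (l1 + d) + M) (count h (l1 + d))); [|lia].
      exfalso. apply N. exists (l1 + d). split; [lia|assumption]. }
    (* With k = weight l1 + M, branching on k q consecutive levels adds k q to the count but only k
       p to the weight, and k q >= k p + k. *)
    apply N. exists (l1 + (weight p q l1 + M) * q). split; [lia|].
    rewrite Hd, weight_add_period by lia. nia. }
  destruct Hreach as (l2 & Hl2 & Hc). exists l2. intros l Hl.
  induction Hl as [|l Hl IH]; [assumption|].
  pose proof (weight_S p q l hpq). rewrite count_S.
  destruct (Nat.eq_dec (count h l) (weight p q l + M)) as [E|E]; [|lia].
  pose proof (Hup l ltac:(lia) ltac:(lia)) as Hs. rewrite count_S in Hs. lia.
Qed.

End Schedule.

(** * String codes and indices of machines *)

Lemma code_str_bounds (u : list bool) : 2 ^ length u <= S (code_str u) < 2 * 2 ^ length u.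
Proof. induction u as [|b u IH]; simpl in *; [lia|]. destruct b; lia. Qed.

Lemma code_str_snoc (u : list bool) (b : bool) :
  code_str (u ++ [b]) = code_str u + 2 ^ length u * (if b then 2 else 1).
Proof. induction u as [|c u IH]; simpl; [destruct b; lia|]. rewrite IH. destruct b, c; lia. Qed.

(** Turns a zero test into halting: the test does not depend on the search variable, so the search
    stops at once or never. *)
Lemma evals_min_const_iff (c : code) (g : nat -> nat) (x : nat) :
  computes c (fun z => g (p1 z)) ->
  (exists y, evals (CMin c) (cpair x 0) y) <-> g x = 0.
Proof.
  intros Hc. split.
  - intros [y [t H]]. revert H. generalize 0 at 1. induction t as [|t IH]; intros k; [discriminate|].
    cbn [eval]. rewrite cunpair_cpair.
    destruct (eval t c (cpair x k)) as [r|] eqn:E; [|discriminate].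
    assert (r = g x) as ->.
    { apply (evals_det c (cpair x k)); [now exists t|].
      specialize (Hc (cpair x k)). cbv beta in Hc. now rewrite p1_cpair in Hc. }
    destruct (g x); [reflexivity|]. apply IH.
  - intros H. specialize (Hc (cpair x 0)). cbv beta in Hc. rewrite p1_cpair, H in Hc.
    eexists. now apply evals_min_0.
Qed.

(* The s-m-n theorem; the minimization ignores its search variable. *)
Lemma computable_index (g : nat -> nat) :
  computable g ->
  exists index, computable index /\
    forall n v, (exists t, conv_in (index n) t v) <-> g (cpair n v) = 0.
Proof.
  intros Hg. destruct (computable_comp g p1 Hg) as [c Hc]; [comp|].
  destruct (decode_surjective (CMin c)) as [m Hm].
  (* As 2 is the number of [CId] and 0 that of [CZero], the inner code sends v to ((n, v), 0). *)
  exists (fun n => comp_number m (pair_number (pair_number (const_number n) 2) 0)). split.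
  - unfold comp_number, pair_number. pose proof computable_const_number. comp.
  - intros n v.
    rewrite <- (evals_min_const_iff c g (cpair n v)) by exact Hc.
    assert (Ha : evals (CPair (CPair (decode (const_number n)) (decode 2)) (decode 0)) v
      (cpair (cpair n v) 0)).
    { apply evals_pair; [apply evals_pair|]; [apply evals_const_number|apply evals_id|apply evals_zero]. }
    unfold conv_in. rewrite decode_comp_number, !decode_pair_number, Hm. split.
    + intros (t & y & H). destruct t as [|t]; [discriminate|]. cbn [eval] in H.
      destruct (eval t (CPair _ _) v) as [z|] eqn:E; [|discriminate].
      rewrite (evals_det _ v _ z Ha) by now exists t. exists y. now exists t.
    + intros [y Hy]. destruct (evals_comp _ _ _ _ _ Ha Hy) as [t Ht]. eauto.
Qed.

(** * Heights extracted from a Sigma03 definition, and the reduction *)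

Section Stages.
Variable f : nat -> nat.

Definition search (n a b w : nat) : nat :=
  bsum (S b) (fun b' => bprod w (fun c => f (cpair n (cpair a (cpair b' c))))).

(* Vanishes exactly when [w] is the least number such that, for every b' <= b, some c < w
   satisfies f(n,a,b',c) = 0; thus each pair (a,b) is certified by at most one [w]. *)
Definition certificate_defect (n a b w : nat) : nat :=
  search n a b w + (1 - search n a b (pred w)).

Definition height (n t : nat) : nat :=
  ifz (certificate_defect n (p1 t) (p1 (p2 t)) (p2 (p2 t))) (p1 t) t.

Lemma search_eq_0 (n a b w : nat) :
  search n a b w = 0 <->
  forall b', b' <= b -> exists c, c < w /\ f (cpair n (cpair a (cpair b' c))) = 0.
Proof.
  unfold search. rewrite bsum_eq_0. setoid_rewrite bprod_eq_0. split.
  - intros H b' Hb. apply H. lia.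
  - intros H b' Hb. apply H. lia.
Qed.

Lemma search_mono (n a b w w' : nat) :
  w <= w' -> search n a b w = 0 -> search n a b w' = 0.
Proof.
  rewrite !search_eq_0. intros Hw H b' Hb. destruct (H b' Hb) as (c & Hc & Hf).
  exists c. split; [lia|assumption].
Qed.

(** If w < w', then w <= w' - 1, so the search already succeeds at the predecessor of w', against
    minimality. *)
Lemma certificate_unique (n a b w w' : nat) :
  certificate_defect n a b w = 0 -> certificate_defect n a b w' = 0 -> w = w'.
Proof.
  unfold certificate_defect. intros H H'.
  destruct (Nat.lt_trichotomy w w') as [L|[L|L]]; [|assumption|].
  - assert (search n a b (pred w') = 0) by (apply (search_mono n a b w); lia). lia.
  - assert (search n a b (pred w) = 0) by (apply (search_mono n a b w'); lia). lia.
Qed.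

Lemma certificate_exists (n a b : nat) :
  (forall b', exists c, f (cpair n (cpair a (cpair b' c))) = 0) ->
  exists w, certificate_defect n a b w = 0.
Proof.
  intros H.
  assert (Hw : exists w, search n a b w = 0).
  { destruct (list_uniform_bound (fun b' c => f (cpair n (cpair a (cpair b' c))) = 0)
      (seq 0 (S b))) as [N HN]; [auto|].
    exists (S N). apply search_eq_0. intros b' Hb.
    destruct (HN b') as (c & Hc & Hf); [apply in_seq; lia|].
    exists c. split; [lia|assumption]. }
  destruct Hw as [w Hw]. induction w as [|w IH].
  (* No c lies below 0, so the search never succeeds at w = 0. *)
  - apply search_eq_0 with (b' := 0) in Hw; [|lia]. destruct Hw as (c & Hc & _). lia.
  - destruct (Nat.eq_dec (search n a b w) 0) as [E|E]; [auto|].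
    exists (S w). unfold certificate_defect. simpl pred. lia.
Qed.

(** The certificate of the pair (a, T) has a code of at least T and height a. *)
Lemma height_liminf (n a : nat) :
  (forall b, exists c, f (cpair n (cpair a (cpair b c))) = 0) ->
  forall T, exists t, T <= t /\ height n t <= a.
Proof.
  intros H T. destruct (certificate_exists n a T H) as [w Hw].
  exists (cpair a (cpair T w)). split.
  - pose proof (cpair_ge_add a (cpair T w)). pose proof (cpair_ge_add T w). lia.
  - unfold height. autorewrite with pairs. rewrite Hw. reflexivity.
Qed.

(** A failure at [b] excludes certificates for all b' >= b, and each b' < b has at most one. *)
Lemma finitely_many_certificates (n a b : nat) :
  (forall c, f (cpair n (cpair a (cpair b c))) <> 0) ->
  exists T, forall b' w, certificate_defect n a b' w = 0 -> cpair a (cpair b' w) <= T.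
Proof.
  intros H.
  destruct (list_uniform_bound (fun b' t => forall w, certificate_defect n a b' w = 0 ->
    cpair a (cpair b' w) <= t) (seq 0 b)) as [T HT].
  { intros b' _. destruct (excluded_middle_informative
      (exists w, certificate_defect n a b' w = 0)) as [[w Hw]|N].
    - exists (cpair a (cpair b' w)). intros w' Hw'.
      now rewrite (certificate_unique n a b' w' w Hw' Hw).
    - exists 0. intros w Hw. exfalso. eauto. }
  exists T. intros b' w Hw. destruct (Nat.lt_ge_cases b' b) as [Hb|Hb].
  - destruct (HT b') as (i & Hi & Hx); [apply in_seq; lia|]. specialize (Hx w Hw). lia.
  - exfalso. unfold certificate_defect in Hw.
    destruct (proj1 (search_eq_0 n a b' w) ltac:(lia) b Hb) as (c & _ & Hc).
    now apply (H c).
Qed.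

Lemma height_lim (n : nat) :
  (forall a, exists b, forall c, f (cpair n (cpair a (cpair b c))) <> 0) ->
  forall M, exists T, forall t, T <= t -> M <= height n t.
Proof.
  intros H M.
  destruct (list_uniform_bound (fun a T => forall b w, certificate_defect n a b w = 0 ->
    cpair a (cpair b w) <= T) (seq 0 M)) as [T HT].
  { intros a _. destruct (H a) as [b Hb]. exact (finitely_many_certificates n a b Hb). }
  (* Beyond [S T] no certificate for any a < M occurs; beyond [M] the default height t is large
     enough. *)
  exists (max M (S T)). intros t Ht.
  destruct (cpair_exists t) as (a & z & ->). destruct (cpair_exists z) as (b & w & ->).
  unfold height. autorewrite with pairs.
  destruct (certificate_defect n a b w) eqn:E; cbn [ifz]; [|lia].
  apply Nat.nlt_ge. intros Ha.
  destruct (HT a) as (i & Hi & Hx); [apply in_seq; lia|]. specialize (Hx b w E). lia.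
Qed.

Hypothesis Hf : computable f.

Lemma computable_height (n t : nat -> nat) :
  computable n -> computable t -> computable (fun x => height (n x) (t x)).
Proof. intros Hn Ht. unfold height, certificate_defect, search. comp. Qed.

Variables p q : nat.
Hypothesis hp : 0 < p.
Hypothesis hpq : p < q.

Definition branching (n l : nat) : nat := branch p q (height n) l.

Lemma computable_branching (n l : nat -> nat) :
  computable n -> computable l -> computable (fun x => branching (n x) (l x)).
Proof.
  intros Hn Hl.
  assert (Hs : computable (fun x => state p q (height (n x)) (l x))).
  { unfold state. apply (computable_rec (fun _ => cpair 0 0) l (fun x l z =>
      ifz (p1 z - (p * l / q + height (n x) (p2 z))) (cpair (S (p1 z)) (S (p2 z))) z));
    repeat first [ progress comp | apply computable_height ]. }
  unfold branching, branch, count, stage.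
  repeat first [ progress comp | apply computable_height ].
Qed.

(* Detects a final 1 at a level [j] that does not branch: the strings of length
   j+1 ending with a 1 are those with 3*2^j <= code + 1 < 4*2^j. *)
Definition violation (n v : nat) : nat :=
  bprod (S v) (fun j => (3 * 2 ^ j - S v) + (S (S v) - 4 * 2 ^ j) + branching n j).

Lemma violation_eq_0 (n : nat) (u : list bool) :
  violation n (code_str u) = 0 <->
  exists v, u = v ++ [true] /\ branching n (length v) = 0.
Proof.
  unfold violation. rewrite bprod_eq_0. split.
  - intros (j & Hj & H). destruct u as [|b u _] using rev_ind.
    + exfalso. simpl in H. pose proof (Nat.pow_nonzero 2 j ltac:(lia)). lia.
    + rewrite code_str_snoc in H. pose proof (code_str_bounds u) as Hb.
      assert (E : j = length u).
      (* For any other j the window of codes misses the block of codes of strings of this length. *)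
      { destruct (Nat.lt_trichotomy j (length u)) as [L|[L|L]]; [|assumption|].
        - pose proof (Nat.pow_le_mono_r 2 (S j) (length u) ltac:(lia) L) as Hp.
          rewrite Nat.pow_succ_r' in Hp. destruct b; lia.
        - pose proof (Nat.pow_le_mono_r 2 (S (length u)) j ltac:(lia) L) as Hp.
          rewrite Nat.pow_succ_r' in Hp. destruct b; lia. }
      subst j. destruct b; [|lia]. exists u. split; [reflexivity|lia].
  - intros (v & -> & Hv). exists (length v). rewrite code_str_snoc.
    pose proof (code_str_bounds v). pose proof (Nat.pow_gt_lin_r 2 (length v) ltac:(lia)).
    split; lia.
Qed.

Lemma computable_violation (n v : nat -> nat) :
  computable n -> computable v -> computable (fun x => violation (n x) (v x)).
Proof.
  intros Hn Hv. unfold violation.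
  repeat first [ progress comp | apply computable_branching ].
Qed.

Lemma Sigma03_set_reduces (B : nat -> Prop) :
  (forall n, B n <-> exists a, forall b, exists c, f (cpair n (cpair a (cpair b c))) = 0) ->
  exists g, computable g /\ forall n, B n <-> Hs_finite (INR p / INR q) (paths (g n)).
Proof.
  intros HB.
  destruct (computable_index (fun z => violation (p1 z) (p2 z))) as (index & Hi & Hindex).
  { apply computable_violation; comp. }
  exists index. split; [assumption|]. intros n.
  (* The machine halts exactly on strings ending with a 1 at a level that does not branch, so the
     surviving paths are those of the homogeneous tree. *)
  assert (HP : forall x, paths (index n) x <-> forall j, x j = true -> branching n j <> 0).
  { intros x. rewrite paths_iff_alive.
    assert (Hconv : forall u, converges (index n) u <->
      exists v, u = v ++ [true] /\ branching n (length v) = 0).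
    { intros u. unfold converges. rewrite Hindex. autorewrite with pairs.
      apply violation_eq_0. }
    split.
    - intros H j Hj Hb. apply (H (S j) (initial x (S j))); [now apply initial_prefix|].
      apply Hconv. exists (initial x j). rewrite initial_S, Hj, initial_length. auto.
    - intros H m r Hr Hc. apply prefix_initial in Hr. destruct Hr as [E _].
      apply Hconv in Hc. destruct Hc as (v & Hv & Hb). subst r.
      rewrite length_app, Nat.add_1_r, initial_S in E. apply app_inj_tail in E.
      destruct E as [_ E]. exact (H (length v) (eq_sym E) Hb). }
  rewrite HB. split.
  - intros [a Ha].
    apply (Hs_finite_of_few_branchings (branching n) (count p q (height n))
      (count_0 p q _) (count_S p q _) (branch_le_1 p q _) p q hp hpq _ HP a).
    apply few_branchings_of_liminf; [assumption|assumption|]. now apply height_liminf.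
  - intros Hfin. apply NNPP. intros N.
    apply (Hs_infinite_of_many_branchings (branching n) (count p q (height n))
      (count_0 p q _) (count_S p q _) (branch_le_1 p q _) p q hp hpq _ HP); [|assumption].
    apply many_branchings_of_lim; [assumption|assumption|]. apply height_lim.
    intros a. apply NNPP. intros Na. apply N. exists a. intros b. apply NNPP. intros Nb.
    apply Na. exists b. intros c Hc. apply Nb. now exists c.
Qed.

End Stages.

Open Scope R_scope.

(* s = p/q ranges over all rationals with 0 < s < 1 *)
Theorem mainTheorem8 (p q : nat) (hp : (0 < p)%nat) (hpq : (p < q)%nat) :
  Sigma03_complete (fun e => Hs_finite (INR p / INR q) (paths e)).
Proof.
  split; [now apply Sigma03_Hs_finite|].
  intros B (f & Hf & HB). now apply (Sigma03_set_reduces f Hf p q hp hpq B).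
Qed.
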